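(* In $\mathbb{R}^n$ with $n\ge2$, for any real number $d\in[n-1,n]$ there exist three (pairwise) disjoint domains $U_1,U_2,U_3$ sharing the same boundary $$W=\partial U_1=\partial U_2=\partial U_3$$ and such that $$\dim_{\sf box}(W)=d.$$
   Context: A domain is a nonempty connected open set. **Minkowski dimension.** For a bounded set $S\subset\mathbb{R}^n$ and $\epsilon>0$ let $N(\epsilon)$ be the (minimal) number of boxes (cubes; squares if $n=2$) of side length $\epsilon$ required to cover $S$. The upper and lower Minkowski dimensions of $S$ are the $\limsup$ and $\liminf$ of $\ln(N(\epsilon))/\ln(1/\epsilon)$ as $\epsilon\to0^+$; when they agree, the common value is the Minkowski dimension $\dim_{\sf box}(S)$. *)

(* Defs.v *)
From mathcomp Require Export all_boot all_order all_algebra.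
From mathcomp Require Export all_classical all_reals all_analysis.

Set Implicit Arguments.
Unset Strict Implicit.
Unset Printing Implicit Defensive.

Export Order.TTheory GRing.Theory Num.Theory.
Export numFieldNormedType.Exports.

Local Open Scope classical_set_scope.
Local Open Scope ring_scope.

Definition domain (T : topologicalType) (U : set T) : Prop :=
  [/\ U !=set0, connected U & open U].

Definition boundary (T : topologicalType) (A : set T) : set T :=
  closure A `\` interior A.

Definition cube (R : realType) (n : nat) (c : 'rV[R]_n) (eps : R) :
    set 'rV[R]_n :=
  [set x | forall i : 'I_n, c 0 i <= x 0 i <= c 0 i + eps].

Definition covered_by_cubes (R : realType) (n : nat) (S : set 'rV[R]_n)
    (eps : R) (k : nat) : Prop :=
  exists c : 'I_k -> 'rV[R]_n, S `<=` \bigcup_(j in setT) cube (c j) eps.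

(* The default value 0 is only used when no finite cover exists, which does
   not happen for bounded S and eps > 0. *)
Definition box_number (R : realType) (n : nat) (S : set 'rV[R]_n) (eps : R) :
    nat :=
  xget 0%N [set k | covered_by_cubes S eps k /\
                    forall l, covered_by_cubes S eps l -> (k <= l)%N].

Definition box_ratio (R : realType) (n : nat) (S : set 'rV[R]_n) (eps : R) :
    \bar R :=
  (ln (box_number S eps)%:R / ln (1 / eps))%:E.

Definition upper_minkowski_dim (R : realType) (n : nat) (S : set 'rV[R]_n) :
    \bar R :=
  limf_esup (box_ratio S) 0^'+.

Definition lower_minkowski_dim (R : realType) (n : nat) (S : set 'rV[R]_n) :
    \bar R :=
  limf_einf (box_ratio S) 0^'+.

(* The dimension is only defined for bounded sets, so boundedness is part of
   the assertion that it exists and equals d. *)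
Definition has_minkowski_dim (R : realType) (n : nat) (S : set 'rV[R]_n)
    (d : R) : Prop :=
  [/\ bounded_set S, upper_minkowski_dim S = d%:E &
      lower_minkowski_dim S = d%:E].

(* Main.v *)
Require Import Defs.
From mathcomp Require Import ring lra zify.

(* The common boundary is a Denjoy-type continuum. Blow up the points of four
   orbits of an irrational rotation of the circle to gaps; this gives a Cantor
   set C on a line. The reflections t |-> 1 - t and t |-> alpha - t of the circle
   permute the gaps, and both preserve each of the four orbits. Above the line
   join every gap to its image under the first reflection by an arch-shaped
   tube, below the line use the second reflection. The tubes over one orbit form
   a connected open chain, each orbit is dense, so the four unions of tubes are
   disjoint domains with the same boundary, which is locally C times an interval.
   In dimension n >= 3 the planar picture is rotated about a line. The gap lengths
   can be chosen so that C has any box dimension s in [0,1], whence dimension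
   n - 1 + s for the boundary. *)

Set Implicit Arguments.
Unset Strict Implicit.
Unset Printing Implicit Defensive.
Local Open Scope classical_set_scope.
Local Open Scope ring_scope.

(** * Orbits of the rotation by sqrt 2 - 1 *)

(** Why four orbits: a reflection t |-> mu - t with mu in Z alpha + Z preserves the class of x
    modulo Z alpha + Z exactly when 2 x lies in Z alpha + Z, and there are four such classes. The
    two reflections compose to the rotation, so crossing alternately above and below the line walks
    through a whole orbit. Why rectangular tubes: a roof occupies the heights 1 + M - x for x in the
    gap of its left foot, so it is a mirror image of the left leg. Hence every boundary point has
    one coordinate which, up to sign and translation, lies in C. Rotating with the sup norm keeps
    this true in all dimensions, and box counting reduces to counting for C. Why quadratic
    exponents: linear terms must be added to the exponents so that the construction survives at s =
    0 and s = 1. Against m ^ 2 these terms, and the jump from one scale to the next, are of lower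
    order, so the dimension is exactly s. *)

Section Orbits.
Variable R : realType.

Definition alpha : R := Num.sqrt 2 - 1.

Lemma alpha_gt0 : 0 < alpha.
Proof. by rewrite /alpha subr_gt0 -[ltLHS]sqrtr1 ltr_sqrt ?ltr0n ?ltr1n. Qed.

Lemma alpha_sqr : alpha ^+ 2 = 1 - 2 * alpha.
Proof. by have := @sqr_sqrtr R 2 (ler0n R 2); rewrite /alpha; lra. Qed.

Lemma alpha_lt1 : 2 * alpha < 1.
Proof. have := alpha_sqr; have := alpha_gt0; nra. Qed.

(** Irrationality of sqrt 2: the hypothesis gives (m + i)^2 = 2 i^2, and for i nonzero the 2-adic
    valuation is even on the left and odd on the right. *)
Lemma alpha_int_eq0 (i m : int) : i%:~R * alpha = m%:~R -> i = 0.
Proof.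
move=> h; have : ((m + i) ^+ 2)%:~R = (2 * i ^+ 2)%:~R :> R.
  have s2 := @sqr_sqrtr R 2 (ler0n R 2).
  by rewrite !(rmorphXn, rmorphM, rmorphD) /= -h /alpha; ring: s2.
move/intr_inj => {}h; apply/eqP; apply: contraT => i0.
have := congr1 (fun z : int => `|z|%N) h; rewrite abszM !abszX /= => {}h.
have := congr1 (logn 2) h.
rewrite lognM ?expn_gt0 ?absz_gt0 ?i0// !lognX.
rewrite (_ : logn 2 2 = 1%N)//; lia.
Qed.

(* The elements (sqrt 2 - 1)^k of Z + Z sqrt 2 are positive and arbitrarily small. *)
Lemma alpha_dense (x y : R) : x < y ->
  exists i m : int, x < i%:~R * alpha + m%:~R < y.
Proof.
move=> xy.
have small k : exists i m : int, i%:~R * alpha + m%:~R = alpha ^+ k.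
  elim: k => [|k [i [m h]]]; first by exists 0, 1; rewrite expr0; ring.
  exists (m - 2 * i), i; rewrite exprS -h.
  have s2 := alpha_sqr; rewrite rmorphB rmorphM /=; ring: s2.
have [k kxy] : exists k, alpha ^+ k < y - x.
  have a1 : `|alpha| < 1.
    by rewrite ger0_norm; have := alpha_lt1; have := alpha_gt0; lra.
  have xy0 : 0 < y - x by rewrite subr_gt0.
  have /cvgrPdist_lt /(_ _ xy0) [k _ /(_ k)] := cvg_expr a1.
  rewrite /= leqnn => /(_ isT); rewrite sub0r normrN ger0_norm ?exprn_ge0 ?ltW ?alpha_gt0//.
  by exists k.
have [i [m h]] := small k.
set g := alpha ^+ k in h kxy; have g0 : 0 < g by rewrite exprn_gt0// alpha_gt0.
pose z := Num.floor (x / g) + 1.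
exists (z * i), (z * m); rewrite !rmorphM /=.
have -> : z%:~R * i%:~R * alpha + z%:~R * m%:~R = z%:~R * g by rewrite -h; ring.
have zl : x / g < z%:~R by rewrite /z floorD1_gt.
have zu : z%:~R <= x / g + 1 by rewrite /z rmorphD /= lerD2r floor_le_tmp.
rewrite ltr_pdivrMr// in zl; rewrite zl /=.
have : z%:~R * g <= (x / g + 1) * g by rewrite ler_pM2r.
rewrite mulrDl mul1r divfK ?gt_eqF//; lra.
Qed.

(** Representatives of the four classes of (Z alpha + Z) / 2 modulo Z alpha + Z. *)
Definition offset (c : bool * bool) : R :=
  ((c.1 : nat)%:R * alpha + (c.2 : nat)%:R) / 2.

Definition orbit (c : bool * bool) (t : R) : Prop :=
  0 <= t < 1 /\ exists i m : int, t = i%:~R * alpha + m%:~R + offset c.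

(** After doubling, the independence of 1 and alpha over Z equates integer coefficients whose
    parities are the two bits of [c]. *)
Lemma orbit_inj c c' t : orbit c t -> orbit c' t -> c = c'.
Proof.
move=> [_ [i [m ->]]] [_ [i' [m']]].
case: c c' => [b e] [b' e']; rewrite /offset /= => h.
have /alpha_int_eq0 h1 : (2 * i + (b : nat)%:Z - 2 * i' - (b' : nat)%:Z)%:~R * alpha
  = (2 * m' + (e' : nat)%:Z - 2 * m - (e : nat)%:Z)%:~R.
  by rewrite !(rmorphB, rmorphD, rmorphM) /= -!pmulrn; lra.
have bb : b = b' by clear h; case: b b' h1 => [] [] /=; lia.
move: h; rewrite {}bb in h1 *; have -> : i = i' by lia.
move=> h; have : (2 * m + (e : nat)%:Z)%:~R = (2 * m' + (e' : nat)%:Z)%:~R :> R.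
  by rewrite !(rmorphB, rmorphD, rmorphM) /= -!pmulrn; lra.
by move=> /intr_inj; case: e e' {h} => [] [] //=; lia.
Qed.

Lemma orbit_dense c (x y : R) : 0 <= x -> y <= 1 -> x < y ->
  exists2 t, orbit c t & x < t < y.
Proof.
move=> x0 y1 xy.
have [i [m /andP[h1 h2]]] := @alpha_dense (x - offset c) (y - offset c) (ltr_leB xy (lexx _)).
exists (i%:~R * alpha + m%:~R + offset c); last by lra.
by split; [lra|exists i, m].
Qed.

Lemma orbit_refl c t k (u : R) : orbit c t -> t + u = alpha + k%:~R \/ t + u = 1 + k%:~R ->
  0 <= u < 1 -> orbit c u.
Proof.
move=> [_ [i [m ->]]] h u01; split=> //.
case: c h => [b e]; rewrite /offset /= => -[] h.
- exists (1 - i - (b : nat)%:Z), (k - m - (e : nat)%:Z).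
  by rewrite !(rmorphB, rmorphD, rmorphM) /= -!pmulrn; lra.
- exists (- i - (b : nat)%:Z), (1 + k - m - (e : nat)%:Z).
  by rewrite !(rmorphB, rmorphN, rmorphD, rmorphM) /= -!pmulrn; lra.
Qed.

Definition orbit_pt c (i : int) : R :=
  let x := i%:~R * alpha + offset c in x - (Num.floor x)%:~R.

Lemma orbit_ptP c i : orbit c (orbit_pt c i).
Proof.
rewrite /orbit_pt /=; set x := _ + offset c; split.
  have := floor_le_tmp x; have := floorD1_gt x; rewrite rmorphD /=; lra.
by exists i, (- Num.floor x); rewrite rmorphN /= /x; lra.
Qed.

Lemma orbitE c t : orbit c t -> exists i, t = orbit_pt c i.
Proof.
move=> [t01 [i [m e]]]; exists i; rewrite /orbit_pt /=.
suff -> : Num.floor (i%:~R * alpha + offset c) = - m by rewrite rmorphN /= e; lra.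
by apply/eqP; rewrite real_floor_eq ?num_real// !rmorphD rmorphN /=; lra.
Qed.

Lemma orbit_pt_inj c : injective (orbit_pt c).
Proof.
move=> i j; rewrite /orbit_pt /=; set m := Num.floor _; set m' := Num.floor _ => h.
have /alpha_int_eq0 : (i - j)%:~R * alpha = (m - m')%:~R.
  by rewrite !rmorphB /=; lra.
by lia.
Qed.

(** The reflection at 1 sends index i to - i - c.1, and the reflection at alpha sends that to i + 1;
    [k1] and [k2] absorb the reduction modulo 1. *)
Lemma orbit_pt_step c i : exists j k1 k2 : int,
  orbit_pt c i + orbit_pt c j = 1 + k1%:~R /\
  orbit_pt c j + orbit_pt c (i + 1) = alpha + k2%:~R.
Proof.
exists (- i - (c.1 : nat)%:Z); rewrite /orbit_pt /=.
set m1 := Num.floor _; set m2 := Num.floor _; set m3 := Num.floor _.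
exists ((c.2 : nat)%:Z - m1 - m2 - 1), ((c.2 : nat)%:Z - m3 - m2); rewrite /offset.
by rewrite !(rmorphB, rmorphN, rmorphD, rmorphM) /= -!pmulrn; split; lra.
Qed.

(** One sequence serves all four orbits because gap lengths are allotted by position in it; any
    injective enumeration will do. *)
Lemma orbit_enum : exists p : nat -> R, injective p /\
  forall t, (exists c, orbit c t) <-> (exists k, p k = t).
Proof.
have cnt : countable [set t : R | exists c, orbit c t].
  apply: (@sub_countable _ _ _ (range (fun x : (bool * bool) * int => orbit_pt x.1 x.2))).
    apply: subset_card_le => t [c /orbitE[i ->]]; by exists (c, i).
  by apply: (sub_countable (card_image_le _ _)); exact: countableP.
have inf : infinite_set [set t : R | exists c, orbit c t].
  apply/infiniteP/pcard_leP/injfunPex; exists (fun k => orbit_pt (false, false) (Posz k)).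
    by move=> k _; exists (false, false); exact: orbit_ptP.
  by move=> k l _ _ /orbit_pt_inj [].
have /card_set_bijP[p [pP pI pS]] := card_esym (eq_card_nat cnt inf).
exists p; split=> [k l|t]; first by move=> /pI; apply; rewrite inE.
split=> [/pS [k _ <-]|[k <-]]; first by exists k.
exact: (pP k).
Qed.

End Orbits.

(** * Gap lengths *)

Section Exponents.
Variables (R : realType) (s : R).
Hypothesis s01 : 0 <= s <= 1.

Definition sq_floor (m : nat) : nat := Num.truncn (s * (m ^ 2)%:R).
(** The summand m lets the number of points used at level m tend to infinity even when s = 0, so
    that every gap gets positive length. *)
Definition cexp (m : nat) : nat := (sq_floor m + m)%N.
Definition wexp (m : nat) : nat := (m ^ 2 + 2 * m - sq_floor m)%N.

Lemma sq_floor_itv m : (sq_floor m)%:R <= s * (m ^ 2)%:R < (sq_floor m).+1%:R.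
Proof. by have := s01; move=> h; apply: truncn_itv; rewrite mulr_ge0//; lra. Qed.

Lemma sq_floor_le m : (sq_floor m <= m ^ 2)%N.
Proof.
have hs := s01; rewrite -(ler_nat R); have /andP[h _] := sq_floor_itv m.
by apply: le_trans h _; rewrite ler_piMl//; lra.
Qed.

Lemma sq_floor_step m :
  (sq_floor m <= sq_floor m.+1)%N /\ (sq_floor m.+1 <= sq_floor m + 2 * m + 2)%N.
Proof.
have hs := s01; have /andP[h1 h2] := sq_floor_itv m; have /andP[h3 h4] := sq_floor_itv m.+1.
have e : ((m.+1 ^ 2)%N%:R = (m ^ 2)%N%:R + 2 * m%:R + 1 :> R).
  by rewrite -addn1 !natrX natrD; ring.
have sm : 0 <= s * m%:R <= m%:R.
  by rewrite mulr_ge0//= ?ler_piMl//; lra.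
rewrite e !mulrDr mulr1 mulrCA in h3 h4.
split; first by rewrite -ltnS -(ltr_nat R); lra.
rewrite -ltnS -(ltr_nat R) -addnS 2!natrD natrM.
by rewrite -natr1 in h2; lra.
Qed.

Lemma cexp_mono m : (cexp m <= cexp m.+1)%N.
Proof. by rewrite /cexp leq_add// (sq_floor_step m).1. Qed.

(** m ^ 2 + 2 m grows by 2 m + 3 and the floor by at most 2 m + 2. The term 2 m in [wexp] is there
    for this: the masses of the levels decay geometrically even when s = 1. *)
Lemma wexp_mono m : (wexp m < wexp m.+1)%N.
Proof.
have := sq_floor_step m; have := sq_floor_le m; have := sq_floor_le m.+1.
rewrite /wexp; lia.
Qed.

Lemma cwexp m : (cexp m + wexp m = m ^ 2 + 3 * m)%N.
Proof. have := sq_floor_le m; rewrite /cexp /wexp; lia. Qed.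

End Exponents.

(** * The distribution function of the gap lengths *)

Section Weights.
Variables (R : realType) (s : R) (p : nat -> R).
Hypothesis s01 : 0 <= s <= 1.
Hypothesis p01 : forall k, 0 <= p k < 1.

Implicit Types S : R -> bool.

Definition hits S (N : nat) : nat := (\sum_(k < N) S (p k))%N.

Lemma hits_le S N : (hits S N <= N)%N.
Proof.
rewrite /hits -[leqRHS]card_ord -sum1_card; apply: leq_sum => i _.
by case: (S _).
Qed.

Definition subcut S S' := forall x, S x -> S' x.

Lemma hits_mono S S' N : subcut S S' -> (hits S N <= hits S' N)%N.
Proof.
move=> h; apply: leq_sum => i _; have := h (p i).
by case: (S (p i)) => // ->.
Qed.

Lemma hits_lt S S' N k : subcut S S' -> (k < N)%N -> ~~ S (p k) -> S' (p k) ->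
  (hits S N < hits S' N)%N.
Proof.
move=> h kN Sk S'k; rewrite /hits (bigD1 (Ordinal kN))//= [ltnRHS](bigD1 (Ordinal kN))//=.
rewrite (negbTE Sk) S'k add0n add1n ltnS; apply: leq_sum => i _; have := h (p i).
by case: (S (p i)) => // ->.
Qed.

(* Each of the first 2 ^ cexp m points receives the mass 2 ^- (cexp m + wexp m)
   from level m, where cexp m is about s m ^ 2 and cexp m + wexp m = m ^ 2 + 3 m:
   there are about e ^- s gaps of length e = 2 ^- (m ^ 2 + 3 m). *)
Definition mass_term S m : R :=
  (hits S (2 ^ cexp s m))%:R * 2 ^- cexp s m * 2 ^- wexp s m.

Lemma mass_term_ge0 S m : 0 <= mass_term S m.
Proof. by rewrite !mulr_ge0// invr_ge0 exprn_ge0. Qed.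

Lemma mass_term_le S m : mass_term S m <= 2 ^- wexp s m.
Proof.
rewrite /mass_term ler_piMl// ?invr_ge0 ?exprn_ge0// ler_pdivrMr ?exprn_gt0// mul1r.
by rewrite -natrX ler_nat hits_le.
Qed.

Lemma mass_term_mono S S' m : subcut S S' -> mass_term S m <= mass_term S' m.
Proof.
by move=> h; rewrite !ler_wpM2r ?invr_ge0 ?exprn_ge0// ler_nat hits_mono.
Qed.

Definition mass_upto S (M : nat) : R := \sum_(m < M) mass_term S m.

Lemma mass_uptoS S M : mass_upto S M.+1 = mass_upto S M + mass_term S M.
Proof. by rewrite /mass_upto big_ord_recr. Qed.

Lemma mass_upto_nd S : nondecreasing_seq (mass_upto S).
Proof. by apply/nondecreasing_seqP => M; rewrite mass_uptoS lerDl mass_term_ge0. Qed.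

(** Each bound 2 ^- wexp is at most half of the preceding one; the subtracted term is what makes the
    induction telescope. *)
Lemma mass_upto_tail S M k : mass_upto S (M + k) <= mass_upto S M + 2 * 2 ^- wexp s M - 2 * 2 ^- wexp s (M + k).
Proof.
elim: k => [|k ih]; first by rewrite addn0; lra.
rewrite addnS mass_uptoS; have := mass_term_le S (M + k).
suff : 2 ^- wexp s (M + k).+1 <= 2 ^- wexp s (M + k) / 2 :> R by lra.
rewrite -invfM -exprSr lef_pV2 ?posrE ?exprn_gt0//.
by rewrite ler_eXn2l ?ltr1n// wexp_mono.
Qed.

Lemma mass_upto_ub S M N : mass_upto S N <= mass_upto S M + 2 * 2 ^- wexp s M.
Proof.
have w0 k : 0 < 2 ^- wexp s k :> R by rewrite invr_gt0 exprn_gt0.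
have [NM|MN] := leqP N M.
  by apply: le_trans (mass_upto_nd S NM) _; rewrite lerDl mulr_ge0// ltW.
have := mass_upto_tail S M (N - M); rewrite (subnKC (ltnW MN)) => /le_trans; apply.
by rewrite gerBl mulr_ge0// ltW.
Qed.

Lemma mass_upto_cvg S : cvgn (mass_upto S).
Proof.
apply: nondecreasing_is_cvgn; first exact: mass_upto_nd.
by exists (mass_upto S 0 + 2 * 2 ^- wexp s 0) => _ [N _ <-]; exact: mass_upto_ub.
Qed.

Definition mass S : R := limn (mass_upto S).

Lemma mass_upto_le S M : mass_upto S M <= mass S.
Proof. by apply: nondecreasing_cvgn_le; [exact: mass_upto_nd|exact: mass_upto_cvg]. Qed.

Lemma mass_le_upto S M : mass S <= mass_upto S M + 2 * 2 ^- wexp s M.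
Proof. by apply: limr_le; [exact: mass_upto_cvg|exact: nearW (mass_upto_ub S M)]. Qed.

Lemma mass_ge0 S : 0 <= mass S.
Proof. by apply: le_trans (mass_upto_le S 0); rewrite /mass_upto big_ord0. Qed.

Lemma mass_le2 S : mass S <= 2.
Proof.
apply: le_trans (mass_le_upto S 0) _; rewrite /mass_upto big_ord0 add0r.
by rewrite /wexp exp0n// expr0 invr1 mulr1.
Qed.

(** Every further level contributes at least as much to the larger set, so the difference of the
    partial sums only grows on the way to the limit. *)
Lemma mass_upto_diff S S' M : subcut S S' -> mass_upto S' M - mass_upto S M <= mass S' - mass S.
Proof.
move=> h; rewrite -lerBrDr opprK addrAC -lerBlDr lerBlDr.
suff : mass S <= mass S' - (mass_upto S' M - mass_upto S M) by lra.
apply: limr_le; first exact: mass_upto_cvg.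
near=> N; have MN : (M <= N)%N by near: N; exact: nbhs_infty_ge.
have := mass_upto_le S' N.
suff : mass_upto S' M - mass_upto S M <= mass_upto S' N - mass_upto S N by lra.
rewrite -(subnKC MN); elim: (N - M)%N => [|k ih]; first by rewrite addn0.
by rewrite addnS !mass_uptoS; have := mass_term_mono (M + k) h; lra.
Unshelve. all: by end_near. Qed.

Lemma mass_mono S S' : subcut S S' -> mass S <= mass S'.
Proof. by move=> h; have := mass_upto_diff 0 h; rewrite /mass_upto !big_ord0; lra. Qed.

Lemma mass_ext S S' : (forall k, S (p k) = S' (p k)) -> mass S = mass S'.
Proof.
move=> h; congr (limn _); apply/funext => M; apply: eq_bigr => m _.
by rewrite /mass_term /hits; congr (_%:R * _ * _); apply: eq_bigr => k _; rewrite h.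
Qed.

Lemma mass_upto_eq S S' M : (forall k, (k < 2 ^ cexp s M)%N -> S (p k) = S' (p k)) ->
  mass_upto S M = mass_upto S' M.
Proof.
move=> h; apply: eq_bigr => m _; rewrite /mass_term /hits; congr (_%:R * _ * _).
apply: eq_bigr => k _; rewrite h//; apply: leq_trans (ltn_ord k) _.
rewrite leq_exp2l//; elim: M m {h k} => [[]//|M ih] m.
have := ltn_ord m; rewrite ltnS leq_eqVlt => /predU1P[->|mM].
  exact: cexp_mono.
by apply: leq_trans (ih (Ordinal mM)) _; exact: cexp_mono.
Qed.

(** Only the levels from M on can tell the two sets apart, and together they carry at most 2 * 2 ^-
    wexp s M. This yields the one-sided continuity below. *)
Lemma mass_close S S' M : (forall k, (k < 2 ^ cexp s M)%N -> S (p k) = S' (p k)) ->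
  mass S' <= mass S + 2 * 2 ^- wexp s M.
Proof.
move=> /mass_upto_eq e; have := mass_le_upto S' M; have := mass_upto_le S M.
by rewrite e; lra.
Qed.

(** The point gained counts at level M, where it alone weighs 2 ^- (cexp s M + wexp s M); the
    partial sums are taken up to M.+1 to include that level. *)
Lemma mass_jump S S' k M : subcut S S' -> (k < 2 ^ cexp s M)%N ->
  ~~ S (p k) -> S' (p k) -> 2 ^- (M ^ 2 + 3 * M) <= mass S' - mass S.
Proof.
move=> h kM Sk S'k; apply: le_trans (mass_upto_diff M.+1 h).
rewrite !mass_uptoS; have : mass_upto S M <= mass_upto S' M by apply: ler_sum => m _; exact: mass_term_mono.
suff : 2 ^- (M ^ 2 + 3 * M) <= mass_term S' M - mass_term S M by lra.
rewrite /mass_term -!mulrBl -(cwexp s01 M) exprD invfM.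
rewrite -mulrA ler_peMl ?mulr_ge0 ?invr_ge0 ?exprn_ge0//.
have : ((hits S (2 ^ cexp s M)).+1 <= hits S' (2 ^ cexp s M))%N by exact: hits_lt kM Sk S'k.
by rewrite -(ler_nat R) -addn1 natrD; lra.
Qed.

Lemma wexp_small (e : R) : 0 < e -> exists M, 2 * 2 ^- wexp s M < e.
Proof.
move=> e0.
have h1 : `|2^-1| < 1 :> R by rewrite ger0_norm ?invr_ge0// invf_lt1 ?ltr1n.
have e2 : 0 < e / 2 by rewrite divr_gt0.
have /cvgrPdist_lt /(_ _ e2) [M _ /(_ M)] := cvg_expr h1.
rewrite /= leqnn => /(_ isT); rewrite sub0r normrN ger0_norm ?exprn_ge0 ?invr_ge0// => h.
exists M; suff : 2 ^- wexp s M <= 2^-1 ^+ M :> R by lra.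
rewrite exprVn lef_pV2 ?posrE ?exprn_gt0// ler_eXn2l ?ltr1n//.
by elim: M {h} => // M ih; apply: leq_ltn_trans ih (wexp_mono s01 M).
Qed.

(** [gapl] and [gapr] are the one-sided limits at t of the distribution function of the point
    masses; the jump between them is the gap. *)
Definition gapl (t : R) := mass (fun x => x < t).
Definition gapr (t : R) := mass (fun x => x <= t).

Lemma gapl_le_gapr t : gapl t <= gapr t.
Proof. by apply: mass_mono => x; exact: ltW. Qed.

Lemma gapr_le_gapl t u : t < u -> gapr t <= gapl u.
Proof. by move=> tu; apply: mass_mono => x /le_lt_trans; exact. Qed.

(** Since k < 2 ^ k <= 2 ^ cexp s k, the point p k already takes part in level k. *)
Lemma gap_lt k : gapl (p k) < gapr (p k).
Proof.
have kM : (k < 2 ^ cexp s k)%N.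
  by apply: leq_trans (ltn_expl k (ltnSn 1)) _; rewrite leq_exp2l// leq_addl.
have := @mass_jump (fun x => x < p k) (fun x => x <= p k) k k (fun x => @ltW _ _ x (p k)) kM.
rewrite ltxx lexx => /(_ isT isT).
have : 0 < 2 ^- (k ^ 2 + 3 * k) :> R by rewrite invr_gt0 exprn_gt0.
by rewrite /gapl /gapr; lra.
Qed.

(** Between two right ends lies the whole gap of the larger index. This separation drives the lower
    box count. *)
Lemma gapr_sep M k l : (k < 2 ^ cexp s M)%N -> (l < 2 ^ cexp s M)%N ->
  p k < p l -> 2 ^- (M ^ 2 + 3 * M) <= gapr (p l) - gapr (p k).
Proof.
move=> kM lM kl; have := gapr_le_gapl kl.
have := @mass_jump (fun x => x < p l) (fun x => x <= p l) l M (fun x => @ltW _ _ x (p l)) lM.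
by rewrite ltxx lexx => /(_ isT isT); rewrite /gapl /gapr; lra.
Qed.

Lemma gap_eq t : (forall k, p k != t) -> gapl t = gapr t.
Proof. by move=> h; apply: mass_ext => k /=; rewrite [RHS]le_eqVlt (negbTE (h k)). Qed.

Lemma avoid_right N t u : t < u ->
  exists2 t', t < t' < u & forall k, (k < N)%N -> p k <= t \/ t' < p k.
Proof.
move=> tu; elim: N => [|N [t' t'tu ih]]; first by exists ((t + u) / 2) => //; lra.
have [pt|tp] := leP (p N) t.
  by exists t' => // k; rewrite ltnS leq_eqVlt => /predU1P[->|/ih//]; left.
exists (Num.min t' ((t + p N) / 2)).
  by rewrite lt_min gt_min; apply/andP; split; [apply/andP; split|apply/orP; left]; lra.
move=> k; rewrite ltnS leq_eqVlt => /predU1P[->|/ih[?|?]]; [right|by left|right].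
  by rewrite gt_min; apply/orP; right; lra.
by rewrite gt_min; apply/orP; left.
Qed.

Lemma avoid_left N t u : u < t ->
  exists2 t', u < t' < t & forall k, (k < N)%N -> t <= p k \/ p k < t'.
Proof.
move=> tu; elim: N => [|N [t' t'tu ih]]; first by exists ((t + u) / 2) => //; lra.
have [pt|tp] := leP t (p N).
  by exists t' => // k; rewrite ltnS leq_eqVlt => /predU1P[->|/ih//]; left.
exists (Num.max t' ((t + p N) / 2)).
  by rewrite lt_max gt_max; apply/andP; split; [apply/orP; left|apply/andP; split]; lra.
move=> k; rewrite ltnS leq_eqVlt => /predU1P[->|/ih[?|?]]; [right|by left|right].
  by rewrite lt_max; apply/orP; right; lra.
by rewrite lt_max; apply/orP; left.
Qed.

Lemma gap_right_cont t u e : t < u -> 0 < e ->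
  exists2 t', t < t' < u & gapl t' < gapr t + e.
Proof.
move=> tu /wexp_small [M Me].
have [t' t't h] := avoid_right (2 ^ cexp s M) tu; exists t' => //.
suff : gapl t' <= gapr t + 2 * 2 ^- wexp s M by lra.
by apply: mass_close => k /h[] kt; apply/idP/idP; lra.
Qed.

Lemma gap_left_cont t u e : u < t -> 0 < e ->
  exists2 t', u < t' < t & gapl t - e < gapr t'.
Proof.
move=> tu /wexp_small [M Me].
have [t' t't h] := avoid_left (2 ^ cexp s M) tu; exists t' => //.
suff : gapl t <= gapr t' + 2 * 2 ^- wexp s M by lra.
by apply: mass_close => k /h[] kt; apply/idP/idP; lra.
Qed.

(** An intermediate value theorem for a function with jumps: t is the supremum of the points with
    gapl t <= v, and one-sided continuity rules out both ways of missing v. *)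
Lemma gap_locate v : 0 <= v <= gapl 1 -> exists t, gapl t <= v <= gapr t.
Proof.
move=> /andP[v0]; rewrite le_eqVlt => /predU1P[->|v1].
  by exists 1; rewrite lexx gapl_le_gapr.
pose E := [set t | gapl t <= v].
have E1 t : E t -> t <= 1.
  move=> Et; rewrite leNgt; apply/negP => /gapr_le_gapl h.
  by move: Et; rewrite /E /=; have := gapl_le_gapr 1; lra.
have E0 : E 0.
  rewrite /E /= (_ : gapl 0 = 0)//; apply/eqP; rewrite eq_le mass_ge0 andbT.
  rewrite /gapl (@mass_ext _ (fun=> false)); last by move=> k; have := p01 k; lra.
  apply: limr_le; first exact: mass_upto_cvg.
  apply: nearW => M; rewrite /mass_upto big1// => m _; rewrite /mass_term /hits big1//.
  by rewrite !mul0r.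
have hE : has_sup E by split; [exists 0|exists 1 => t /E1].
exists (sup E); apply/andP; split.
- rewrite leNgt; apply/negP => h.
  have e0 : 0 < gapl (sup E) - v by lra.
  have s1 : sup E - 1 < sup E by rewrite gtrBl.
  have [t /andP[_ ts] th] := gap_left_cont s1 e0.
  have [u Eu tu] := sup_adherent (etrans (subr_gt0 _ _) ts) hE.
  by rewrite subKr in tu; have := gapr_le_gapl tu; move: Eu; rewrite /E /=; lra.
- rewrite leNgt; apply/negP => h.
  have e0 : 0 < v - gapr (sup E) by lra.
  have s1 : sup E < sup E + 1 by rewrite ltrDl.
  have [t /andP[ts _] th] := gap_right_cont s1 e0.
  have : E t by rewrite /E /=; lra.
  by move=> /(ub_le_sup hE.2); lra.
Qed.

Definition is_cut S := exists t, S = (fun x => x < t) \/ S = (fun x => x <= t).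

Lemma cut_total S S' : is_cut S -> is_cut S' -> subcut S S' \/ subcut S' S.
Proof.
move=> [t h] [t' h'].
have [tt|tt|tt] := ltgtP t t'; [left|right|].
- by case: h h' => -> [] -> x; lra.
- by case: h h' => -> [] -> x; lra.
rewrite {}tt in h; case: h h' => -> [] ->; [left|left|right|left] => x; lra.
Qed.

Definition mass_from S M := mass S - mass_upto S M.

(* Along the chain of cuts both the number of the first points passed and the
   accumulated tail are monotone, so their sum (with the tail in units of e)
   indexes the intervals of length e needed to cover all cut values. *)
Lemma cuts_cover M e : 2 ^- (M ^ 2 + 3 * M) <= e ->
  exists c : 'I_(4 * 2 ^ cexp s M) -> R,
    forall S, is_cut S -> exists j, c j <= mass S <= c j + e.
Proof.
move=> Me; set N := (2 ^ cexp s M)%N.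
have e0 : 0 < e by apply: lt_le_trans Me; rewrite invr_gt0 exprn_gt0.
pose stat S : nat := (hits S N + Num.truncn (mass_from S M / e))%N.
have tail_ge0 S : 0 <= mass_from S M by rewrite subr_ge0 mass_upto_le.
have tr S : (Num.truncn (mass_from S M / e))%:R <= mass_from S M / e
    < (Num.truncn (mass_from S M / e)).+1%:R.
  by apply: truncn_itv; rewrite divr_ge0// ltW.
(* The hits number at most N. The tail is at most 2 * 2 ^- wexp s M, which is 2 N times 2 ^- (M ^ 2
   + 3 M), hence at most 2 N e. The index is thus at most 3 N. *)
have stat_lt S : (stat S < 4 * N)%N.
  have N0 : (0 < N)%N by rewrite expn_gt0.
  suff : (Num.truncn (mass_from S M / e) <= 2 * N)%N.
    by have := hits_le S N; rewrite /stat; lia.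
  rewrite -(ler_nat R); have /andP[h _] := tr S; apply: le_trans h _.
  rewrite ler_pdivrMr//.
  have : mass_from S M <= 2 * 2 ^- wexp s M by have := mass_le_upto S M; rewrite /mass_from; lra.
  move=> /le_trans; apply; rewrite natrM -mulrA ler_pM2l//.
  apply: le_trans (_ : N%:R * 2 ^- (M ^ 2 + 3 * M) <= _); last by rewrite ler_pM2l// ltr0n.
  rewrite -(cwexp s01 M) /N natrX exprD invfM mulrA divff ?mul1r//.
pose V j := [set mass S | S in [set S | is_cut S /\ stat S = j]].
exists (fun j => inf (V j)) => S cS.
exists (Ordinal (stat_lt S)) => /=.
have VS : V (stat S) (mass S) by exists S.
apply/andP; split.
  by apply: ge_inf => //; exists 0 => _ [S' _ <-]; exact: mass_ge0.
rewrite -lerBlDr; apply: lb_le_inf; first by exists (mass S).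
move=> _ [S' [cS' eS'] <-].
have [/mass_mono|h] := cut_total cS cS'; first by lra.
have c1 := hits_mono N h.
have tm : mass_from S' M <= mass_from S M by have := mass_upto_diff M h; rewrite /mass_from; lra.
have c2 : (Num.truncn (mass_from S' M / e) <= Num.truncn (mass_from S M / e))%N.
  by apply: le_truncn; rewrite ler_pM2r// invr_gt0.
have [d1 d2] : hits S' N = hits S N /\
    Num.truncn (mass_from S' M / e) = Num.truncn (mass_from S M / e).
  by move: eS'; rewrite /stat; lia.
have hd : mass_upto S' M = mass_upto S M.
  apply: mass_upto_eq => k kN; apply/idP/idP; first exact: h.
  move=> Sk; apply: contraT => S'k; have := hits_lt h kN S'k Sk.
  by rewrite -/N d1 ltnn.
have : mass_from S M / e < mass_from S' M / e + 1.
  have := tr S; have := tr S'; rewrite d2 -addn1 natrD; lra.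
rewrite -[X in _ < _ + X](divff (lt0r_neq0 e0)) -mulrDl ltr_pM2r ?invr_gt0//.
by rewrite /mass_from hd; lra.
Qed.

End Weights.

(** * The planar picture *)

(* The gap at t is the interval ]a t, b t[; it is empty unless t lies on an orbit. *)
Record gap_system (R : realType) (a b : R -> R) : Prop := GapSystem {
  gs_le : forall t, a t <= b t;
  gs_lt : forall t u, t < u -> b t <= a u;
  gs_open : forall c t, orbit c t -> a t < b t;
  gs_closed : forall t, ~ (exists c, orbit c t) -> a t = b t;
  gs_right : forall t u e, t < u -> 0 < e -> exists2 t', t < t' < u & a t' < b t + e;
  gs_left : forall t u e, u < t -> 0 < e -> exists2 t', u < t' < t & a t - e < b t';
  gs_locate : forall v, 0 <= v <= a 1 -> exists t, a t <= v <= b t;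
  gs_bound : forall t, 0 <= a t <= 2
}.

Section Plane.
Variables (R : realType) (a b : R -> R).
Hypothesis G : gap_system a b.
Implicit Types (l r t u v x h e mu : R) (c : bool * bool).

Lemma a_mono t u : t <= u -> a t <= a u.
Proof.
rewrite le_eqVlt => /predU1P[->//|tu].
by have := gs_lt G tu; have := gs_le G t; lra.
Qed.

Lemma b_mono t u : t <= u -> b t <= b u.
Proof.
rewrite le_eqVlt => /predU1P[->//|tu].
by have := gs_lt G tu; have := gs_le G u; lra.
Qed.

Lemma ab_le t u : a t < b u -> t <= u.
Proof. by move=> h; rewrite leNgt; apply/negP => /(gs_lt G); lra. Qed.

Lemma bb_lt t u : b t < b u -> t < u.
Proof. by move=> h; rewrite ltNge; apply/negP => /b_mono; lra. Qed.

Definition mid (l r : R) : R := (l + r) / 2.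

(* Coordinates: x along the line carrying the gaps, h the height above it.
   The arch joining the gaps at t and l + r - t is tube l r t. *)
Definition outer l r t (x h : R) : Prop :=
  [/\ a t < x, x < b (l + r - t), -1 < h & h < 1 + a (mid l r) - a t].
Definition inner l r t (x h : R) : Prop :=
  [/\ b t <= x, x <= a (l + r - t) & h <= 1 + a (mid l r) - b t].
Definition tube l r t x h : Prop := outer l r t x h /\ ~ inner l r t x h.

(* On the side mu (1 above, alpha below) the reflection t |-> mu - t mod 1 of the
   circle splits into the reflections of [0, mu] and [mu, 1]; the gaps at 0 and mu
   open into the unbounded region. *)
Definition outside mu (x h : R) : Prop :=
  [/\ -1 < h, ~ inner 0 mu 0 x h & ~ inner mu 1 mu x h].

(** An arch is named by its left foot. The minimum makes the piece depend only on the pair formed by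
    t and its reflection. *)
Definition piece mu t : R -> R -> Prop :=
  if (t == 0) || (t == mu) then outside mu
  else if t < mu then tube 0 mu (Num.min t (0 + mu - t))
  else tube mu 1 (Num.min t (mu + 1 - t)).

Lemma inner_mono l r t u x h : t <= u -> inner l r u x h -> inner l r t x h.
Proof.
move=> tu [h1 h2 h3].
have tu' : l + r - u <= l + r - t by lra.
by have := b_mono tu; have := a_mono tu'; split; lra.
Qed.

(** Arches are nested: legs and roof of a later one stay under an earlier one. Disjointness of the
    tubes comes from this. *)
Lemma outer_sub_inner l r t u x h : t < u -> outer l r u x h -> inner l r t x h.
Proof.
move=> tu [h1 h2 h3 h4].
have tu' : l + r - u < l + r - t by lra.
by have := gs_lt G tu; have := gs_lt G tu'; split; lra.
Qed.

Lemma not_outer l r t x h : -1 < h -> ~ outer l r t x h ->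
  [\/ x <= a t, b (l + r - t) <= x | 1 + a (mid l r) - a t <= h].
Proof.
move=> h1 no; have [?|h2] := leP x (a t); first by constructor 1.
have [?|h3] := leP (b (l + r - t)) x; first by constructor 2.
by have [?|h4] := leP (1 + a (mid l r) - a t) h; [constructor 3|case: no].
Qed.

Lemma tubeP l r t x h : tube l r t x h <-> [/\ a t < x, x < b (l + r - t),
    -1 < h, h < 1 + a (mid l r) - a t &
    [\/ x < b t, a (l + r - t) < x | 1 + a (mid l r) - b t < h]].
Proof.
split=> [[[? ? ? ?] ni]|[? ? ? ? u]].
  split=> //; have [?|x1] := ltP x (b t); first by constructor 1.
  have [?|x2] := ltP (a (l + r - t)) x; first by constructor 2.
  by have [?|x3] := ltP (1 + a (mid l r) - b t) h; [constructor 3|case: ni].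
by split=> // -[x1 x2 x3]; case: u; rewrite ltNge ?x1 ?x2 ?x3.
Qed.

Lemma tube_left l r t x h : t <= mid l r -> a t < x < b t -> -1 < h ->
  h < 1 + a (mid l r) - a t -> tube l r t x h.
Proof.
rewrite /mid => tm /andP[x1 x2] h1 h2; apply/tubeP; split=> //; last by constructor 1.
by apply: lt_le_trans x2 (b_mono _); lra.
Qed.

Lemma tube_right l r t x h : t <= mid l r -> a (l + r - t) < x < b (l + r - t) -> -1 < h ->
  h < 1 + a (mid l r) - a t -> tube l r t x h.
Proof.
rewrite /mid => tm /andP[x1 x2] h1 h2; apply/tubeP; split=> //; last by constructor 2.
by apply: le_lt_trans (a_mono _) x1; lra.
Qed.

Lemma tube_low l r t x h : t <= mid l r -> -1 < h < 1 ->
  a t < x < b t \/ a (l + r - t) < x < b (l + r - t) -> tube l r t x h.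
Proof.
move=> tm /andP[h1 h2]; have aM := a_mono tm.
have h3 : h < 1 + a (mid l r) - a t by lra.
by case=> hx; [exact: tube_left|exact: tube_right].
Qed.

(** Here U, U' bound the region under the arch u, and A, B, A', B' the legs of an arch just inside
    it. A point between them is moved by at most e when its coordinates are clamped to the midlines
    of the legs and of the roof. *)
Lemma clamp_into (A B A' B' U U' M x h e : R) :
  A < B -> A' < B' -> B <= A' -> B <= M -> U <= x -> x <= U' -> h <= 1 + M - U -> 0 <= h ->
  B < U + e -> U' - e < A' -> 0 < e -> [\/ x <= A, B' <= x | 1 + M - A <= h] ->
  exists x1 h1, [/\ A < x1, x1 < B', -1 < h1, h1 < 1 + M - A &
    [\/ x1 < B, A' < x1 | 1 + M - B < h1]] /\ [/\ `|x1 - x| <= e & `|h1 - h| <= e].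
Proof.
move=> ? ? ? ? ? ? ? ? ? ? ?.
have h1P : exists h1, [/\ -1 < h1, h1 < 1 + M - A, `|h1 - h| <= e &
    1 + M - A <= h -> 1 + M - B < h1].
  have [?|?] := leP h (1 + M - (A + B) / 2); [exists h|exists (1 + M - (A + B) / 2)];
    by split; rewrite ?ler_norml; lra.
case: h1P => h1 [? ? ? hh] no.
have [x1|x1] := leP x ((A + B) / 2).
  exists ((A + B) / 2), h1; rewrite ler_norml; split; split=> //; try lra.
  by constructor 1; lra.
have [x2|x2] := leP ((A' + B') / 2) x.
  exists ((A' + B') / 2), h1; rewrite ler_norml; split; split=> //; try lra.
  by constructor 2; lra.
exists x, h1; rewrite subrr normr0; split; split=> //; try lra.
by case: no => ?; [lra|lra|constructor 3; exact: hh].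
Qed.

(** The opposite position: the point is under the arch with legs A, B, A', B' and not inside the
    slightly smaller arch with outer edges U, U'. Moving one coordinate to the midline of a leg or
    of the roof suffices. *)
Lemma push_out (A B A' B' U U' M x h e : R) :
  A < B -> A' < B' -> B <= A' -> B <= M -> B <= x -> x <= A' -> h <= 1 + M - B -> 0 <= h ->
  U - e < A -> B' < U' + e -> 0 < e -> [\/ x <= U, U' <= x | 1 + M - U <= h] ->
  exists x1 h1, [/\ A < x1, x1 < B', -1 < h1, h1 < 1 + M - A &
    [\/ x1 < B, A' < x1 | 1 + M - B < h1]] /\ [/\ `|x1 - x| <= e & `|h1 - h| <= e].
Proof.
move=> ? ? ? ? ? ? ? ? ? ? ? [?|?|?].
- exists ((A + B) / 2), h; rewrite subrr normr0 ler_norml.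
  by split; split; try lra; constructor 1; lra.
- exists ((A' + B') / 2), h; rewrite subrr normr0 ler_norml.
  by split; split; try lra; constructor 2; lra.
- exists x, (1 + M - (A + B) / 2); rewrite subrr normr0 ler_norml.
  by split; split; try lra; constructor 3; lra.
Qed.

Lemma tube_near_case_above l r u x h c e : l < r -> 0 <= l -> r <= 1 ->
  l <= u < mid l r -> 0 <= h -> inner l r u x h ->
  (forall v, u < v <= mid l r -> ~ inner l r v x h) ->
  (forall c t, l < t < r -> orbit c t -> orbit c (l + r - t)) -> 0 < e ->
  exists t x1 h1, [/\ orbit c t, l < t < mid l r, tube l r t x1 h1,
    `|x1 - x| <= e & `|h1 - h| <= e].
Proof.
move=> lr l0 r1 um h0 [i1 i2 i3] above refl e0.
have mE : mid l r = (l + r) / 2 by [].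
have [t1 t1m ht1] := gs_right G (proj2 (andP um)) e0.
have um' : mid l r < l + r - u by lra.
have [t2 t2m ht2] := gs_left G um' e0.
have uw : u < Num.min t1 (l + r - t2) by rewrite lt_min; apply/andP; split; lra.
have w1 : Num.min t1 (l + r - t2) <= 1.
  by rewrite ge_min; apply/orP; left; lra.
have u0 : 0 <= u by lra.
have [q oq /andP[uq]] := orbit_dense c u0 w1 uw.
rewrite lt_min => /andP[qt1 qt2].
have lq : l < q < r by lra.
have oq' := refl _ _ lq oq.
have g1 := gs_open G oq; have g2 := gs_open G oq'.
have b1 := gs_lt G qt1.
have t2q : t2 < l + r - q by lra.
have b2 := gs_lt G t2q.
have qq : q < l + r - q by lra.
have b3 := gs_lt G qq.
have qm : q < mid l r by lra.
have b4 := gs_lt G qm.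
(* A point inside the outer contour of q would lie under the intermediate arch (u + q) / 2, whose
   index exceeds u. *)
have no : ~ outer l r q x h.
  have h2 : (u + q) / 2 < q by lra.
  by move=> /(outer_sub_inner h2); apply: above; lra.
have hm1 : -1 < h by lra.
have b1' : b q < b u + e by lra.
have b2' : a (l + r - u) - e < a (l + r - q) by lra.
have [x1 [h1 [/tubeP tu [d1 d2]]]] :=
  clamp_into g1 g2 b3 b4 i1 i2 i3 h0 b1' b2' e0 (not_outer hm1 no).
by exists q, x1, h1; rewrite qm andbT; split=> //; case/andP: lq.
Qed.

Lemma tube_near_case_below l r u x h c e : l < r -> 0 <= l -> r <= 1 ->
  l < u <= mid l r -> 0 <= h -> ~ outer l r u x h ->
  (forall v, l < v < u -> inner l r v x h) ->
  (forall c t, l < t < r -> orbit c t -> orbit c (l + r - t)) -> 0 < e ->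
  exists t x1 h1, [/\ orbit c t, l < t < mid l r, tube l r t x1 h1,
    `|x1 - x| <= e & `|h1 - h| <= e].
Proof.
move=> lr l0 r1 um h0 no below refl e0.
have mE : mid l r = (l + r) / 2 by [].
have [t1 t1m ht1] := gs_left G (proj1 (andP um)) e0.
have um' : l + r - u < r by lra.
have [t2 t2m ht2] := gs_right G um' e0.
have uw : Num.max t1 (l + r - t2) < u by rewrite gt_max; apply/andP; split; lra.
have w1 : 0 <= Num.max t1 (l + r - t2).
  by rewrite le_max; apply/orP; left; lra.
have u0 : u <= 1 by lra.
have [q oq /andP[+ uq]] := orbit_dense c w1 u0 uw.
rewrite gt_max => /andP[qt1 qt2].
have lq : l < q < r by lra.
have oq' := refl _ _ lq oq.
have g1 := gs_open G oq; have g2 := gs_open G oq'.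
have b1 := gs_lt G qt1.
have t2q : l + r - q < t2 by lra.
have b2 := gs_lt G t2q.
have qq : q < l + r - q by lra.
have b3 := gs_lt G qq.
have qm : q < mid l r by lra.
have b4 := gs_lt G qm.
have lqu : l < q < u by lra.
have [i1 i2 i3] := below _ lqu.
have hm1 : -1 < h by lra.
have b1' : a u - e < a q by lra.
have b2' : b (l + r - q) < b (l + r - u) + e by lra.
have [x1 [h1 [/tubeP tu [d1 d2]]]] :=
  push_out g1 g2 b3 b4 i1 i2 i3 h0 b1' b2' e0 (not_outer hm1 no).
by exists q, x1, h1; rewrite qm andbT; split=> //; case/andP: lq.
Qed.

(* Let u be the largest index such that (x, h) lies under the arch u; arches
   of any colour with index slightly beyond or slightly before u pass close
   to (x, h). *)
Lemma tube_near l r x h c e : l < r -> 0 <= l -> r <= 1 ->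
  0 <= h -> inner l r l x h ->
  (forall c t, orbit c t -> l < t <= mid l r -> ~ tube l r t x h) ->
  (forall c t, l < t < r -> orbit c t -> orbit c (l + r - t)) -> 0 < e ->
  exists t x1 h1, [/\ orbit c t, l < t < mid l r, tube l r t x1 h1,
    `|x1 - x| <= e & `|h1 - h| <= e].
Proof.
move=> lr l0 r1 h0 il nt refl e0.
have mE : mid l r = (l + r) / 2 by [].
pose E := [set u | l <= u <= mid l r /\ inner l r u x h].
have El : E l by split => //; lra.
have Eb : ubound E (mid l r) by move=> u [/andP[]].
have hE : has_sup E by split; [exists l|exists (mid l r)].
set u := sup E.
have ul : l <= u by apply: ub_le_sup => //; exists (mid l r).
have um : u <= mid l r by apply: ge_sup => //; exists l.
have above v : u < v <= mid l r -> ~ inner l r v x h.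
  move=> uv iv; have : E v by split=> //; lra.
  by move=> /(ub_le_sup hE.2); rewrite -/u; lra.
have below v : l < v < u -> inner l r v x h.
  move=> lv; have d0 : 0 < u - v by lra.
  have [w [_ iw] vw] := sup_adherent d0 hE.
  by apply: inner_mono iw; rewrite -/u in vw; lra.
(* If the supremum is attained, arches slightly beyond u are used, except at u = mid l r. There the
   point has x = a u, which the open outer contour excludes, so arches before u serve. *)
have [iu|niu] := pselect (inner l r u x h).
  move: um; rewrite le_eqVlt => /predU1P[um|um].
    apply: (tube_near_case_below (u := u)) => //; first by lra.
    rewrite um => -[h1 _ _ _]; rewrite um in iu; case: iu => _ + _.
    have -> : l + r - mid l r = mid l r by lra.
    by move=> *; lra.
  by apply: (tube_near_case_above (u := u)) => //; lra.
have lu : l < u.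
  rewrite lt_neqAle ul andbT; apply/eqP => lu; by apply: niu; rewrite -lu.
apply: (tube_near_case_below (u := u)) => //; first by lra.
(* Between the outer and inner contours of u lies only the tube u. It misses the point by hypothesis
   when u is on an orbit, and is empty otherwise. *)
move=> ou; have [[c' oc']|noc] := pselect (exists c, orbit c u).
  by apply: (nt _ _ oc'); [lra|split].
apply: niu; case: ou => o1 o2 o3 o4.
have e1 := gs_closed G noc.
have e2 : a (l + r - u) = b (l + r - u).
  apply: (gs_closed G) => -[c' oc']; apply: noc; exists c'.
  have -> : u = l + r - (l + r - u) by lra.
  by apply: refl => //; lra.
by split; lra.
Qed.

Definition side (mu : R) := mu = 1 \/ mu = alpha R.

Lemma side_gt0 mu : side mu -> 0 < mu.
Proof. by have := alpha_gt0 R => ? -[]->; lra. Qed.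

Lemma side_le1 mu : side mu -> mu <= 1.
Proof. by have := alpha_lt1 R; have := alpha_gt0 R => ? ? -[]->; lra. Qed.

Lemma orbit0 : orbit (false, false) (0 : R).
Proof.
by split; [lra|exists 0, 0; rewrite /offset /=; lra].
Qed.

Lemma orbit_side mu : side mu -> mu < 1 -> orbit (false, false) mu.
Proof.
move=> [->|->] h; first lra.
by split; [have := alpha_gt0 R; lra|exists 1, 0; rewrite /offset /=; lra].
Qed.

Lemma side_refl mu c t u (k : int) : side mu -> orbit c t -> t + u = mu + k%:~R ->
  0 <= u < 1 -> orbit c u.
Proof.
by move=> [->|->] oc h u01; apply: (orbit_refl oc _ u01); [right|left]; exact: h.
Qed.

Definition family mu l r := (l = 0 /\ r = mu) \/ (l = mu /\ r = 1).

Lemma family_refl mu l r c t : side mu -> family mu l r -> l < t < r -> orbit c t ->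
  orbit c (l + r - t).
Proof.
move=> sm f lt oc; have m1 := side_le1 sm; have m0 := side_gt0 sm.
case: f => -[lE rE].
- by apply: (side_refl (k := 0) sm oc); rewrite ?rmorph0; lra.
- by apply: (side_refl (k := 1) sm oc); rewrite ?rmorph1; lra.
Qed.

Lemma pieceP mu c t : side mu -> orbit c t ->
  [/\ c = (false, false), t = 0 \/ t = mu & piece mu t = outside mu] \/
  exists l r, [/\ family mu l r, l < t < r &
    piece mu t = tube l r (Num.min t (l + r - t))].
Proof.
move=> sm oc; have m1 := side_le1 sm; have m0 := side_gt0 sm.
have t01 := oc.1; rewrite /piece.
have [t0|t0] := eqVneq t 0.
  left; split=> //; last by left.
  by apply: orbit_inj oc _; rewrite t0; exact: orbit0.
have [tm|tm] := eqVneq t mu.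
  left; split=> //; last by right.
  by apply: orbit_inj oc _; rewrite tm; apply: orbit_side => //; lra.
right; have tp : 0 < t by rewrite lt_neqAle eq_sym t0; lra.
have [tm'|tm'] := ltP t mu => /=.
  by exists 0, mu; split => //; [left|lra].
exists mu, 1; split => //; first by right.
by rewrite [mu < t]lt_neqAle eq_sym tm; lra.
Qed.

Lemma piece_tube mu l r c t : side mu -> family mu l r -> orbit c t -> l < t <= mid l r ->
  piece mu t = tube l r t.
Proof.
move=> sm f oc lt; rewrite /mid in lt.
have m1 := side_le1 sm; have m0 := side_gt0 sm; have t01 := oc.1.
have tm : Num.min t (l + r - t) = t by apply: min_l; lra.
rewrite -[X in tube _ _ X]tm /piece.
case: f => -[lE rE]; subst l r.
- have t0 : 0 < t by lra.
  have t1 : t < mu by lra.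
  by rewrite (gt_eqF t0) (lt_eqF t1) t1.
- have t0 : 0 < t by lra.
  have t1 : mu < t by lra.
  by rewrite (gt_eqF t0) (gt_eqF t1) (lt_gtF t1).
Qed.

Lemma family_mid mu l r : side mu -> family mu l r -> b l <= a (mid l r).
Proof.
move=> sm f; have m1 := side_le1 sm; have m0 := side_gt0 sm.
rewrite /mid; case: f => -[-> ->]; first by apply: (gs_lt G); lra.
move: m1; rewrite le_eqVlt => /predU1P[->|m1]; last by apply: (gs_lt G); lra.
have -> : (1 + 1) / 2 = 1 :> R by lra.
by rewrite (gs_closed G)// => -[c [/andP[_]]]; lra.
Qed.

(** The abscissae of the lake [c] at heights between -1 and 1, where both sides show the same
    pattern; the unbounded region has colour (false, false). *)
Definition band c x := (exists2 t, orbit c t & a t < x < b t) \/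
  (c = (false, false) /\ (x < b 0 \/ a 1 < x)).

Lemma band_disj c c' x : band c x -> band c' x -> c = c'.
Proof.
have key t c1 : orbit c1 t -> a t < x < b t -> x < b 0 \/ a 1 < x -> c1 = (false, false).
  move=> oc xt [x0|x1].
    have /ab_le t0 : a t < b 0 by lra.
    have t0' : t = 0 by have := oc.1; lra.
    by apply: orbit_inj oc _; rewrite t0'; exact: orbit0.
  exfalso; have /ab_le : a 1 < b t by lra.
  by have := oc.1; lra.
move=> [[t oc xt]|[-> x0]] [[u oc' xu]|[-> x0']] //.
- have /ab_le tu : a t < b u by lra.
  have /ab_le ut : a u < b t by lra.
  by apply: orbit_inj oc _; have -> : t = u by lra.
- exact: key oc xt x0'.
- by rewrite (key _ _ oc' xu x0).
Qed.

(** No roof reaches below height 1, since b u <= a (mid l r) for u < mid l r. The arch at u = mid l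
    r is collapsed onto a single gap. *)
Lemma piece_band mu c t x h : side mu -> orbit c t -> piece mu t x h -> h < 1 -> band c x.
Proof.
move=> sm oc + h1; have m1 := side_le1 sm; have m0 := side_gt0 sm.
case: (pieceP sm oc) => [[-> _ ->]|[l [r [f lt ->]]]].
  move=> [h2 n1 n2].
  have f1 : family mu 0 mu by left.
  have f2 : family mu mu 1 by right.
  have := family_mid sm f1; have := family_mid sm f2.
  have [x0|x0] := ltP x (b 0); first by right; split=> //; left.
  have [x1|x1] := ltP (a 1) x; first by right; split=> //; right.
  move=> M1 M2; left.
  have {n1}xm : a mu < x.
    rewrite ltNge; apply/negP => xm; apply: n1; split=> //; last by lra.
    by have -> : 0 + mu - 0 = mu by lra.
  have {n2}xm' : x < b mu.
    rewrite ltNge; apply/negP => xm'; apply: n2; split=> //; last by lra.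
    by have -> : mu + 1 - mu = 1 by lra.
  exists mu; last by lra.
  apply: (orbit_side sm); rewrite lt_neqAle m1 andbT; apply/eqP => mu1.
  by have := gs_closed G; move=> /(_ 1) e1; rewrite mu1 e1 in xm xm'; [lra|move=> -[c' [/andP[_]]]; lra].
have oc' := family_refl sm f lt oc.
set u := Num.min _ _.
have uE : (u = t /\ t <= l + r - t) \/ (u = l + r - t /\ l + r - t <= t).
  by rewrite /u; case: (leP t (l + r - t)) => ?; [left|right]; split=> //; exact: ltW.
have ou : orbit c u by case: uE => -[-> _].
have ou' : orbit c (l + r - u).
  case: uE => -[-> _] //; have -> : l + r - (l + r - t) = t by lra.
  exact: oc.
have um : u <= mid l r by rewrite /mid; case: uE => -[-> ?]; lra.
move=> [[ o1 o2 o3 o4] ni]; left.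
move: um; rewrite le_eqVlt => /predU1P[um|um].
  by exists u => //; move: o2; rewrite (_ : l + r - u = u); [lra|rewrite um /mid; lra].
have := gs_lt G um => M.
have [xb|xb] := ltP x (b u); first by exists u => //; rewrite o1.
exists (l + r - u) => //; rewrite o2 andbT ltNge; apply/negP => xa.
by apply: ni; split=> //; lra.
Qed.

(** Arches of one family with different indices are nested, the two families are kept apart by the
    position of mu, and the outside avoids both. Equal indices mean that t' is t or its reflection,
    hence on the same orbit. *)
Lemma piece_disj mu c c' t t' x h : side mu -> orbit c t -> orbit c' t' ->
  piece mu t x h -> piece mu t' x h -> c = c'.
Proof.
move=> sm oc oc'; have m1 := side_le1 sm; have m0 := side_gt0 sm.
have key l r t1 x1 h1 : family mu l r -> l < t1 < r ->
    tube l r (Num.min t1 (l + r - t1)) x1 h1 -> outside mu x1 h1 -> False.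
  move=> f lt [ ou _] [_ n1 n2].
  have lm : l < Num.min t1 (l + r - t1) by rewrite lt_min; apply/andP; split; lra.
  have := outer_sub_inner lm ou.
  by case: f => -[lE rE]; rewrite lE rE.
have key2 l r l' r' t1 t2 x1 h1 : family mu l r -> family mu l' r' ->
    l < t1 < r -> l' < t2 < r' -> tube l r (Num.min t1 (l + r - t1)) x1 h1 ->
    tube l' r' (Num.min t2 (l' + r' - t2)) x1 h1 -> l' <= l.
  move=> f f' lt lt' [[_ + _ _] _] [[+ _ _ _] _].
  have hm : l + r - Num.min t1 (l + r - t1) < r by case: (leP t1 (l + r - t1)) => ?; lra.
  have hm' : l' < Num.min t2 (l' + r' - t2) by case: (leP t2 (l' + r' - t2)) => ?; lra.
  have := gs_lt G hm; have := gs_lt G hm'.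
  case: f f' => -[lE rE] [] [lE' rE'].
  - lra.
  - by have := gs_le G mu; rewrite lE rE lE' rE' => *; exfalso; lra.
  - lra.
  - lra.
case: (pieceP sm oc) => [[-> _ ->]|[l [r [f lt ->]]]];
  case: (pieceP sm oc') => [[-> _ ->]|[l' [r' [f' lt' ->]]]] //.
- by move=> po pt; case: (key _ _ _ _ _ f' lt' pt po).
- by move=> pt po; case: (key _ _ _ _ _ f lt pt po).
move=> p1 p2.
have h1 := key2 _ _ _ _ _ _ _ _ f f' lt lt' p1 p2.
have h2 := key2 _ _ _ _ _ _ _ _ f' f lt' lt p2 p1.
have [el er] : l' = l /\ r' = r.
  by move: f f' => [] [lE rE] [] [lE' rE']; split; lra.
subst l' r'.
move: p1 p2; set u := Num.min t _; set u' := Num.min t' _ => -[p1 q1] [p2 q2].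
have [uu|uu|uu] := ltgtP u u'.
- by case: q1; exact: outer_sub_inner uu p2.
- by case: q2; exact: outer_sub_inner uu p1.
have : t' = t \/ t' = l + r - t.
  by move: uu; rewrite /u /u'; case: (leP t) => ?; case: (leP t') => ?; lra.
move=> [tt|tt]; first by apply: orbit_inj oc _; rewrite -tt.
by apply: orbit_inj (family_refl sm f lt oc) _; rewrite -tt.
Qed.

Definition cutval v := exists t, v = a t \/ v = b t.

Lemma cutval_or_gap v : 0 <= v <= a 1 -> cutval v \/ exists c t, orbit c t /\ a t < v < b t.
Proof.
move=> /(gs_locate G)[t /andP[]].
rewrite le_eqVlt => /predU1P[<- _|av]; first by left; exists t; left.
rewrite le_eqVlt => /predU1P[->|vb]; first by left; exists t; right.
right; have [[c oc]|noc] := pselect (exists c, orbit c t); first by exists c, t; rewrite av.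
by have := gs_closed G noc; lra.
Qed.

Lemma not_outside mu x h : side mu -> -1 < h -> ~ outside mu x h ->
  exists l r, [/\ family mu l r, l < r & inner l r l x h].
Proof.
move=> sm h1 no; have m1 := side_le1 sm; have m0 := side_gt0 sm.
have [i1|i1] := pselect (inner 0 mu 0 x h); first by exists 0, mu; split=> //; left.
have [i2|i2] := pselect (inner mu 1 mu x h); last by case: no.
move: m1; rewrite le_eqVlt => /predU1P[mu1|m1]; last by exists mu, 1; split=> //; right.
(* For mu = 1 the second family shrinks to the point a 1 = b 1. A point under it has x = a 1 and
   height at most 1, so it also lies under the first family. *)
case: i1; subst mu; case: i2.
have a1 : a 1 = b 1 by apply: (gs_closed G) => -[c [/andP[_]]]; lra.
rewrite (_ : mid 1 1 = 1); last by rewrite /mid; lra.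
have := family_mid sm (or_introl (conj erefl erefl)).
have := b_mono (ltW m0).
rewrite (_ : 1 + 1 - 1 = 1); last by lra.
move=> *; split; [lra| |lra].
by have -> : 0 + 1 - 0 = 1 :> R by lra.
Qed.

Lemma inner_bounds mu l r x h : side mu -> family mu l r -> inner l r l x h ->
  [/\ 0 <= x <= 2, b l <= x, x <= a r & h <= 3].
Proof.
move=> sm f [h1 + h3]; rewrite (_ : l + r - l = r); last by lra.
have m1 := side_le1 sm; have m0 := side_gt0 sm => h2.
have := gs_bound G l; have := gs_le G l; have := gs_bound G r; have := gs_bound G (mid l r).
by split => //; lra.
Qed.

(** Otherwise x lies in a gap t and, from height 1 on, the roof coordinate 1 + M - h in a gap s. If
    x is outside the contour of arch s, the leg at x belongs to a larger arch and reaches above h;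
    if not, the point is in the roof of s. Either way it is in a piece. *)
Lemma piece_cover mu x h : side mu -> 0 <= h ->
  (forall c t, orbit c t -> ~ piece mu t x h) ->
  [/\ 0 <= x <= 2, h <= 3 & [\/ cutval x, cutval (1 + a (mid 0 mu) - h)
    | cutval (1 + a (mid mu 1) - h)]].
Proof.
move=> sm h0 np; have m1 := side_le1 sm; have m0 := side_gt0 sm.
have hm1 : -1 < h by lra.
have no : ~ outside mu x h by move: (np _ _ orbit0); rewrite /piece eqxx.
have [l [r [f lr il]]] := not_outside sm hm1 no.
have [x02 bx xa h3] := inner_bounds sm f il.
split=> //.
have lr01 : 0 <= l /\ r <= 1 by case: f => -[-> ->]; split; lra.
case: (lr01) => l0 r1.
suff [?|?] : cutval x \/ cutval (1 + a (mid l r) - h).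
- by constructor 1.
- by case: f => -[lE rE]; subst l r; [constructor 2|constructor 3].
have [? _] := andP x02.
have xa1 : x <= a 1 by have := a_mono r1; lra.
have x0a1 : 0 <= x <= a 1 by lra.
have [?|[c [t [ oc xt]]]] := cutval_or_gap x0a1; first by left.
have lt : l < t < r.
  apply/andP; split; rewrite ltNge; apply/negP => tl.
    by have := b_mono tl; lra.
  by have := a_mono tl; lra.
have oc' := family_refl sm f lt oc.
right; case: il => i1 i2 i3.
have mE : mid l r = (l + r) / 2 by [].
have mr : a (mid l r) <= a 1 by apply: a_mono; lra.
have bl := gs_bound G l; have bl' := gs_le G l.
have [h1|h1] := ltP h 1.
  (* at height below 1 the point lies in the foot of an arch *)
  have hh : -1 < h < 1 by rewrite hm1.
  exfalso; have [tm|tm] := leP t (mid l r).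
    have lt' : l < t <= mid l r by rewrite tm andbT; case/andP: lt.
    by apply: (np _ _ oc); rewrite (piece_tube sm f oc lt'); apply: tube_low => //; left.
  have lt' : l < l + r - t <= mid l r by lra.
  apply: (np _ _ oc'); rewrite (piece_tube sm f oc' lt'); case/andP: lt' => _ ?.
  by apply: tube_low => //; right; rewrite subKr.
have v01 : 0 <= 1 + a (mid l r) - h <= a 1 by lra.
have [//|[c' [s [ os vs]]]] := cutval_or_gap v01.
exfalso.
have sm' : s < mid l r.
  by rewrite ltNge; apply/negP => /a_mono; lra.
have ls : l < s by rewrite ltNge; apply/negP => /b_mono; lra.
have lst : l < s <= mid l r by rewrite ls ltW.
case/andP: vs => vs1 vs2; case/andP: xt => xt1 xt2.
have h4 : h < 1 + a (mid l r) - a s by lra.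
have [xs|xs] := leP x (a s).
  have ts : t < s by rewrite ltNge; apply/negP => /a_mono ts; have := lt_le_trans xt1 (le_trans xs ts); rewrite ltxx.
  have tm := lt_trans ts sm'.
  have lt' : l < t <= mid l r by rewrite (ltW tm) andbT; case/andP: lt.
  apply: (np _ _ oc); rewrite (piece_tube sm f oc lt').
  apply: tube_left; rewrite ?xt1 ?(ltW tm)//.
  by apply: lt_le_trans h4 _; rewrite lerD2l lerN2 a_mono// ltW.
have [xs'|xs'] := leP (b (l + r - s)) x.
  have st : l + r - s < t.
    by rewrite ltNge; apply/negP => /b_mono ts; have := lt_le_trans xt2 (le_trans ts xs'); rewrite ltxx.
  have st' : l + r - t < s by lra.
  have tm := lt_trans st' sm'.
  have lt' : l < l + r - t <= mid l r by rewrite (ltW tm) andbT; lra.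
  apply: (np _ _ oc'); rewrite (piece_tube sm f oc' lt').
  apply: tube_right; rewrite ?subKr ?xt1 ?(ltW tm)//.
  by apply: lt_le_trans h4 _; rewrite lerD2l lerN2 a_mono// ltW.
apply: (np _ _ os); rewrite (piece_tube sm f os lst); apply/tubeP; split=> //.
by constructor 3; lra.
Qed.

Lemma piece_near mu x h c e : side mu -> 0 <= h ->
  (forall c t, orbit c t -> ~ piece mu t x h) -> 0 < e ->
  exists t x1 h1, [/\ orbit c t, piece mu t x1 h1, `|x1 - x| <= e & `|h1 - h| <= e].
Proof.
move=> sm h0 np e0; have m1 := side_le1 sm; have m0 := side_gt0 sm.
have hm1 : -1 < h by lra.
have no : ~ outside mu x h by move: (np _ _ orbit0); rewrite /piece eqxx.
have [l [r [f lr il]]] := not_outside sm hm1 no.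
have lr01 : 0 <= l /\ r <= 1 by case: f => -[-> ->]; split; lra.
have [t [x1 [h1 [ oc lt tu d1 d2]]]] :
  exists t x1 h1, [/\ orbit c t, l < t < mid l r, tube l r t x1 h1,
    `|x1 - x| <= e & `|h1 - h| <= e].
  apply: tube_near => //; try lra.
  - by move=> c' t oc lt; rewrite -(piece_tube sm f oc lt); exact: np oc.
  - by move=> c' t lt; exact: family_refl sm f lt.
exists t, x1, h1; split=> //.
by rewrite (piece_tube sm f oc)//; lra.
Qed.

Lemma band_right_end c c' t : orbit c t -> ~ band c' (b t).
Proof.
move=> oc [[s os /andP[h1 h2]]|[_ [h|h]]].
- by have := ab_le h1; have := bb_lt h2; lra.
- by have := bb_lt h; have := oc.1; lra.
- by have := ab_le h; have := oc.1; lra.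
Qed.

Lemma piece_refl mu t t' (k : int) : side mu -> 0 <= t < 1 -> 0 <= t' < 1 ->
  t + t' = mu + k%:~R -> piece mu t = piece mu t'.
Proof.
move=> sm t01 t01' e; have m1 := side_le1 sm; have m0 := side_gt0 sm.
have k1 : -2 < k by rewrite -(@ltr_int R); lra.
have k2 : k < 2 by rewrite -(@ltr_int R); lra.
(* The value k = -1 forces mu = 1 and t = t' = 0. *)
have [kE|[kE|kE]] : k = -1 \/ k = 0 \/ k = 1 by lia.
- rewrite kE rmorphN1 in e.
  by have -> : t = t' by lra.
- rewrite kE rmorph0 addr0 in e; have -> : t' = mu - t by lra.
  rewrite /piece; have [->|t0] := eqVneq t 0; first by rewrite !subr0 eqxx orbT.
  have [->|tm] := eqVneq t mu; first by rewrite subrr eq_refl orbT.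
  rewrite (_ : mu - t == 0 = false); last by rewrite subr_eq0 eq_sym (negbTE tm).
  rewrite (_ : mu - t == mu = false) /=; last first.
    by apply/negbTE; apply: contra t0 => /eqP h; apply/eqP; lra.
  have t0' : 0 < t by rewrite lt_neqAle eq_sym t0; lra.
  have tm' : t < mu by rewrite lt_neqAle tm; lra.
  rewrite tm' (_ : mu - t < mu); last by lra.
  by rewrite !add0r subKr minC.
- rewrite kE rmorph1 in e; have -> : t' = mu + 1 - t by lra.
  have t0 : 0 < t by lra.
  have t1 : mu < t by lra.
  have t2 : 0 < mu + 1 - t by lra.
  have t3 : mu < mu + 1 - t by lra.
  rewrite /piece (gt_eqF t0) (gt_eqF t1) (gt_eqF t2) (gt_eqF t3) (lt_gtF t1) (lt_gtF t3).
  by rewrite subKr minC.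
Qed.

Lemma piece_foot mu c t x h : side mu -> orbit c t -> a t < x < b t -> -1 < h < 1 ->
  piece mu t x h.
Proof.
move=> sm oc xt hh; have m1 := side_le1 sm; have m0 := side_gt0 sm.
case: (pieceP sm oc) => [[_ [t0|tm] ->]|[l [r [f lt _]]]].
- subst t; split; first lra.
    by move=> []; lra.
  by move=> [h1 _ _]; have := b_mono (ltW m0); lra.
- subst t; split; first lra.
    by move=> [_ + _]; rewrite (_ : 0 + mu - 0 = mu); lra.
  by move=> []; lra.
have oc' := family_refl sm f lt oc.
have mE : mid l r = (l + r) / 2 by [].
have [tm|tm] := leP t (mid l r).
  have lt' : l < t <= mid l r by lra.
  by rewrite (piece_tube sm f oc lt'); apply: tube_low => //; left.
have lt' : l < l + r - t <= mid l r by lra.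
rewrite (@piece_refl mu t (l + r - t) (if l == 0 then 0 else 1))//.
- rewrite (piece_tube sm f oc' lt'); case/andP: lt' => _ ?.
  by apply: tube_low => //; right; rewrite subKr.
- exact: oc.1.
- exact: oc'.1.
- case: f => -[lE rE]; subst l r; first by rewrite eqxx rmorph0; lra.
  by rewrite gt_eqF// rmorph1; lra.
Qed.

End Plane.

(** * Rotation into dimension m + 2 *)

Section Connected.
Variable T : topologicalType.
Implicit Types S A B : set T.

Lemma conn_sub S A p q : A `<=` S -> connected A -> A p -> A q -> connected_component S p q.
Proof. by move=> AS cA Ap Aq; exact: (connected_component_max Ap AS cA). Qed.

Lemma conn_all S : (forall p q, S p -> S q -> connected_component S p q) -> connected S.
Proof.
move=> h; have [[p Sp]|S0] := pselect (S !=set0).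
  have -> : S = connected_component S p.
    by apply/seteqP; split; [move=> q; exact: h|exact: connected_component_sub].
  exact: component_connected.
have -> : S = set0 by apply/seteqP; split=> // p Sp; apply: S0; exists p.
exact: connected0.
Qed.

Lemma connected_star S B : B `<=` S -> connected B ->
  (forall p, S p -> exists A, [/\ A `<=` S, connected A, A p & A `&` B !=set0]) ->
  connected S.
Proof.
move=> BS cB h; apply: conn_all => p q /h[A [AS cA Ap [p' [Ap' Bp']]]]
  /h[A' [AS' cA' Aq [q' [Aq' Bq']]]].
apply: connected_component_trans (conn_sub AS cA Ap Ap') _.
apply: connected_component_trans (conn_sub BS cB Bp' Bq') _.
exact: conn_sub AS' cA' Aq' Aq.
Qed.

End Connected.

Section Rows.
Variables (R : realType) (m : nat).
Local Notation V := 'rV[R]_m.+2.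
Implicit Types (p q : V) (x r e : R) (i j : 'I_m.+1).

Definition ax p : R := p 0 ord0.
Definition co p i : R := p 0 (lift ord0 i).
Definition mk x (y : 'I_m.+1 -> R) : V :=
  \row_i (if unlift ord0 i is Some j then y j else x).

Lemma ax_mk x y : ax (mk x y) = x.
Proof. by rewrite /ax mxE unlift_none. Qed.

Lemma co_mk x y i : co (mk x y) i = y i.
Proof. by rewrite /co mxE liftK. Qed.

(* The coordinate transverse to the axis: a signed coordinate in the plane, and
   in higher dimension the sup-norm distance to the axis. *)
Definition rad p : R :=
  if m == 0 then co p ord0 else \big[Num.max/0]_i `|co p i|.

Lemma co_le_rad p i : 0 < rad p -> `|co p i| <= rad p.
Proof.
rewrite /rad; case: eqVneq => [m0|_ _]; last by apply: le_bigmax.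
have -> : i = ord0 by apply/val_inj => /=; have := ltn_ord i; lia.
by move=> /ltW/ger0_norm ->.
Qed.

Lemma rad_attained p : 0 < rad p -> exists i, `|co p i| = rad p.
Proof.
rewrite /rad; case: eqVneq => [m0|_].
  by move=> /ltW/ger0_norm ?; exists ord0.
move=> h; have [i _ e] := @eq_bigmax _ _ _ 0 ord0 xpredT (fun i => `|co p i|) isT (fun i _ => normr_ge0 _).
by exists i.
Qed.

Lemma rad_eq p i : co p i >= 0 -> (m == 0 -> i = ord0) -> (forall j, `|co p j| <= `|co p i|) ->
  rad p = co p i.
Proof.
move=> p0 mi h; rewrite /rad; case: ifP => [/mi -> //|_].
rewrite -[RHS]ger0_norm//; apply/eqP; rewrite eq_le le_bigmax andbT.
by apply/bigmax_leP; split.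
Qed.

Lemma rad_scale p q x : 0 <= x -> (forall i, co q i = x * co p i) -> rad q = x * rad p.
Proof.
move=> x0 h; rewrite /rad; case: eqP => _; first exact: h.
under eq_bigr do rewrite h normrM (ger0_norm x0).
by rewrite [RHS](big_morph ( *%R x) (id1 := 0) (op1 := Num.max)) ?mulr0// => u v; rewrite maxr_pMr.
Qed.

Lemma rad_lip p q e : 0 <= e -> (forall i, `|co p i - co q i| <= e) -> rad p <= rad q + e.
Proof.
move=> e0 h; rewrite /rad; case: eqP => _.
  by have := h ord0; rewrite ler_norml; lra.
apply/bigmax_leP; split; first by rewrite addr_ge0// bigmax_ge_id.
move=> i _; have := @le_bigmax _ _ _ 0 (fun i => `|co q i|) i.
by have := ler_normD (co p i - co q i) (co q i); have := h i; rewrite subrK; lra.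
Qed.

Lemma ax_continuous : continuous ax.
Proof. exact: coord_continuous. Qed.

Lemma rad_continuous : continuous rad.
Proof.
move=> p; apply/(@cvgrPdist_le _ _ _ _ (nbhs_filter p)) => e e0; apply/nbhs_ballP; exists e => //= q [_ hq].
have h i : `|co p i - co q i| <= e by apply/ltW; have := hq 0 (lift ord0 i).
have h' i : `|co q i - co p i| <= e by rewrite distrC.
have := rad_lip (ltW e0) h; have := rad_lip (ltW e0) h'.
by rewrite ler_norml; lra.
Qed.

Definition segment_closed (S : set V) := forall p q t, S p -> S q -> 0 <= t <= 1 ->
  S (p + t *: (q - p)).

Lemma segment_closed_connected S : segment_closed S -> connected S.
Proof.
move=> h; apply: conn_all => p q Sp Sq.
pose f (t : R) : V := p + t *: (q - p).
apply: (@conn_sub _ _ (f @` `[0, 1])).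
- by move=> _ [t /= t01 <-]; apply: h => //; rewrite in_itv in t01.
- apply: connected_continuous_connected; first exact: segment_connected.
  apply: continuous_subspaceT => t; apply: cvgD; first exact: cvg_cst.
  by apply: cvgZr_tmp; exact: cvg_id.
- by exists 0; rewrite /= ?in_itv /= ?lexx ?ler01// /f scale0r addr0.
- by exists 1; rewrite /= ?in_itv /= ?lexx ?ler01// /f scale1r subrKC.
Qed.

Lemma ax_seg p q t : ax (p + t *: (q - p)) = ax p + t * (ax q - ax p).
Proof. by rewrite /ax !mxE. Qed.

Lemma co_seg p q t i : co (p + t *: (q - p)) i = co p i + t * (co q i - co p i).
Proof. by rewrite /co !mxE. Qed.

Lemma interval_seg (I : set R) x y t : is_interval I -> I x -> I y -> 0 <= t <= 1 ->
  I (x + t * (y - x)).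
Proof.
move=> iI Ix Iy t01; have [xy|yx] := leP x y; [apply: (iI _ _ Ix Iy)|apply: (iI _ _ Iy Ix)];
  nra.
Qed.

Section Rect.
Variables I J : set R.
Hypotheses (iI : is_interval I) (iJ : is_interval J).

Definition rect : set V := [set p | I (ax p) /\ J (rad p)].

Let face i (s : R) : set V :=
  [set p | [/\ I (ax p), J (s * co p i) & forall j, `|co p j| <= s * co p i]].

Let face_connected i s : connected (face i s).
Proof.
apply: segment_closed_connected => p q t [p1 p2 p3] [q1 q2 q3] t01; split.
- by rewrite ax_seg; exact: interval_seg.
- rewrite co_seg mulrDr mulrCA mulrBr; exact: interval_seg.
- move=> j; rewrite !co_seg; have := p3 j; have := q3 j; rewrite !ler_norml.
  by move=> /andP[? ?] /andP[? ?]; apply/andP; split; nra.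
Qed.

Let face_sub i s : (m == 0 -> False) -> s ^+ 2 = 1 -> face i s `<=` rect.
Proof.
move=> m0 s1 p [p1 p2 p3]; split=> //.
have s0 : `|s| = 1 by apply/eqP; rewrite -sqrp_eq1// -normrX s1 normr1.
have e : `|co p i| = s * co p i.
  by rewrite -[LHS]mul1r -s0 -normrM ger0_norm//; apply: le_trans (p3 i).
suff -> : rad p = s * co p i by [].
rewrite /rad; case: ifP => [/m0 //|_]; rewrite -e.
by apply/eqP; rewrite eq_le le_bigmax andbT; apply/bigmax_leP; split=> // j _; rewrite e.
Qed.

Let corner x r (i j : 'I_m.+1) (s t : R) : V :=
  mk x (fun k => if k == i then s * r else if k == j then t * r else 0).

Let faces_linked x r i j s t : (m == 0 -> False) -> i != j -> s ^+ 2 = 1 -> t ^+ 2 = 1 ->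
  I x -> 0 <= r -> J r -> face i s (corner x r i j s t) /\ face j t (corner x r i j s t).
Proof.
move=> m0 ij s1 t1 Ix r0 Jr.
have sg u : u ^+ 2 = 1 -> u * (u * r) = r by rewrite mulrA -expr2 => ->; rewrite mul1r.
have nm u : u ^+ 2 = 1 -> `|u * r| = r.
  move=> u1; rewrite normrM (ger0_norm r0).
  by have -> : `|u| = 1; [apply/eqP; rewrite -sqrp_eq1// -normrX u1 normr1|rewrite mul1r].
have nr k : `|co (corner x r i j s t) k| <= r.
  by rewrite co_mk; case: ifP => _; [|case: ifP => _]; rewrite ?nm ?normr0.
split; split; rewrite ?ax_mk//.
- by rewrite co_mk eqxx sg.
- by move=> k; rewrite [co _ i]co_mk eqxx sg.
- by rewrite co_mk eq_sym (negbTE ij) eqxx sg.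
- by move=> k; rewrite [co _ j]co_mk eq_sym (negbTE ij) eqxx sg.
Qed.

(** For m = 0 the set is convex. For m > 0 a sup-norm shell is a union of convex faces, on which a
    fixed signed coordinate attains the norm; faces of different coordinates share a corner
    point. *)
Lemma rect_connected : connected rect.
Proof.
have [m0|m0] := eqVneq m 0%N.
  apply: segment_closed_connected => p q t [p1 p2] [q1 q2] t01; split.
    by rewrite ax_seg; exact: interval_seg.
  by move: p2 q2; rewrite /rad (introT eqP m0) co_seg => ? ?; exact: interval_seg.
have m0' : m == 0 -> False by move=> /eqP e; rewrite e eqxx in m0.
have cover p : rect p -> exists i s, s ^+ 2 = 1 /\ face i s p.
  move=> [p1]; rewrite /rad (negbTE m0).
  have [i _ e] := @eq_bigmax _ _ _ 0 ord0 xpredT (fun i => `|co p i|) isT (fun i _ => normr_ge0 _).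
  rewrite e => p2.
  have [s [s1 se]] : exists s : R, s ^+ 2 = 1 /\ s * co p i = `|co p i|.
    have [c0|c0] := leP 0 (co p i).
      by exists 1; rewrite expr1n mul1r ger0_norm.
    by exists (-1); rewrite sqrrN expr1n mulN1r ltr0_norm.
  exists i, s; split=> //; split=> //; rewrite se// => j.
  by rewrite -e; exact: le_bigmax.
have link1 i s j t p q : i != j -> s ^+ 2 = 1 -> t ^+ 2 = 1 -> face i s p -> face j t q ->
    connected_component rect p q.
  move=> ij s1 t1 fp fq; have [p1 p2 p3] := fp.
  have r0 : 0 <= s * co p i := le_trans (normr_ge0 _) (p3 i).
  have [c1 c2] := faces_linked m0' ij s1 t1 p1 r0 p2.
  apply: connected_component_trans (conn_sub (face_sub m0' s1) (@face_connected _ _) fp c1) _.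
  exact: conn_sub (face_sub m0' t1) (@face_connected _ _) c2 fq.
apply: conn_all => p q /cover[i [s [s1 fp]]] /cover[j [t [t1 fq]]].
(* Opposite faces do not meet, so they are linked through a face of another coordinate k. *)
have [ij|ij] := eqVneq i j; last exact: link1 ij s1 t1 fp fq.
subst j; pose k : 'I_m.+1 := if i == ord0 then ord_max else ord0.
have ik : i != k.
  rewrite /k; case: (eqVneq i ord0) => // -> .
  by apply/eqP => /(congr1 val) /= /esym/eqP /m0'.
have [p1 p2 p3] := fp.
have r0 : 0 <= s * co p i := le_trans (normr_ge0 _) (p3 i).
have one1 : 1 ^+ 2 = 1 :> R by rewrite expr1n.
have [c1 c2] := faces_linked m0' ik s1 one1 p1 r0 p2.
apply: connected_component_trans (conn_sub (face_sub m0' s1) (@face_connected _ _) fp c1) _.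
by apply: link1 c2 fq => //; rewrite eq_sym.
Qed.

End Rect.
End Rows.

(** * The lakes and their common boundary *)

Section Domains.
Variables (R : realType) (m : nat) (a b : R -> R).
Hypothesis G : gap_system a b.
Local Notation V := 'rV[R]_m.+2.
Implicit Types (p q : V) (x h e t u l r mu : R) (c : bool * bool) (s : bool).

(* s = true is the side above the axis of the picture, s = false the side below;
   the axis of the picture is the sphere (or point) of radius 10. *)
Definition height s p : R := if s then rad p - 10 else 10 - rad p.
Definition mu_of s : R := if s then 1 else alpha R.
Definition arch s t : set V := [set p | piece a b (mu_of s) t (ax p) (height s p)].

Lemma side_mu s : side (mu_of s).
Proof. by case: s; [left|right]. Qed.

Lemma height_continuous s : continuous (height s).
Proof.
move=> p; have rc := @rad_continuous R m p.
by case: s; [exact: (cvgB rc (cvg_cst _))|exact: (cvgB (cvg_cst _) rc)].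
Qed.

Lemma open_gtf (f : V -> R) x : continuous f -> open [set p | x < f p].
Proof. by move=> cf; apply: (open_comp (f := f) (D := [set y | x < y])) => //; exact: open_gt. Qed.

Lemma open_ltf (f : V -> R) x : continuous f -> open [set p | f p < x].
Proof. by move=> cf; apply: (open_comp (f := f) (D := [set y | y < x])) => //; exact: open_lt. Qed.

Lemma open_notin l r h s : open [set p | ~ [/\ l <= ax p, ax p <= r & height s p <= h]].
Proof.
have -> : [set p | ~ [/\ l <= ax p, ax p <= r & height s p <= h]] =
    [set p | ax p < l] `|` [set p | r < ax p] `|` [set p | h < height s p].
  apply/seteqP; split=> p /=.
    have [h1|h1] := ltP (ax p) l; first by left; left.
    have [h2|h2] := ltP r (ax p); first by left; right.
    by have [h3|h3] := ltP h (height s p); [right|case].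
  by move=> [[|]|] => h1 []; lra.
apply: openU; last by apply: open_gtf; exact: height_continuous.
by apply: openU; [apply: open_ltf|apply: open_gtf]; exact: ax_continuous.
Qed.

Lemma open_tube l r t s : open [set p : V | tube a b l r t (ax p) (height s p)].
Proof.
have -> : [set p : V | tube a b l r t (ax p) (height s p)] =
    [set p | a t < ax p] `&` [set p | ax p < b (l + r - t)] `&`
    [set p | -1 < height s p] `&` [set p | height s p < 1 + a (mid l r) - a t] `&`
    [set p | ~ inner a b l r t (ax p) (height s p)].
  by apply/seteqP; split=> p /=; [move=> [[? ? ? ?] ?]|move=> [[[[? ?] ?] ?] ?]].
apply: openI; last exact: open_notin.
by repeat apply: openI; (apply: open_gtf || apply: open_ltf);
  (exact: height_continuous || exact: ax_continuous).
Qed.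

Lemma open_arch s t : open (arch s t).
Proof.
rewrite /arch /piece; case: ifP => _; last by case: ifP => _; exact: open_tube.
have -> : [set p : V | outside a b (mu_of s) (ax p) (height s p)] =
  [set p | -1 < height s p] `&` [set p | ~ inner a b 0 (mu_of s) 0 (ax p) (height s p)]
  `&` [set p | ~ inner a b (mu_of s) 1 (mu_of s) (ax p) (height s p)].
  by apply/seteqP; split=> p /=; [move=> [? ? ?]|move=> [[? ?] ?]].
apply: openI; last exact: open_notin.
by apply: openI; [apply: open_gtf; exact: height_continuous|exact: open_notin].
Qed.

Lemma point_exists x s h : -1 <= h <= 4 -> exists p : V, ax p = x /\ height s p = h.
Proof.
move=> hh; pose r : R := if s then 10 + h else 10 - h.
have r0 : 0 <= r by rewrite /r; case: (s); lra.
pose p : V := mk x (fun i => if i == ord0 then r else 0).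
have rp : rad p = r.
  rewrite (@rad_eq _ _ _ ord0) ?co_mk ?eqxx// => j.
  by rewrite !co_mk; case: (j == ord0); rewrite ?normr0.
by exists p; rewrite ax_mk /height rp /r; split=> //; case: (s); lra.
Qed.

Lemma strip_connected (I J : set R) s : is_interval I -> is_interval J ->
  connected [set p : V | I (ax p) /\ J (height s p)].
Proof.
move=> iI iJ; pose J' : set R := [set r | J (if s then r - 10 else 10 - r)].
apply: (@rect_connected _ _ I J') => // x y Jx Jy z xyz.
by move: Jx Jy; rewrite /J' /=; case: (s) => Jx Jy;
  [apply: (iJ _ _ Jx Jy)|apply: (iJ _ _ Jy Jx)]; lra.
Qed.

Lemma tube_connected l r t s : t <= mid l r -> a t < b t -> a (l + r - t) < b (l + r - t) ->
  connected [set p : V | tube a b l r t (ax p) (height s p)].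
Proof.
move=> tm g g'; set M := a (mid l r).
have aM : a t <= M by exact: (a_mono G tm).
have bb : b t <= b (l + r - t) by apply: (b_mono G); rewrite /mid in tm; lra.
have aa : a t <= a (l + r - t) by apply: (a_mono G); rewrite /mid in tm; lra.
(* A height inside the roof bar at which both legs meet it. The bound 4 comes from a <= 2, and the
   case split keeps h0 above -1 when the gap is long. *)
have [h0 [k1 k2 k3 k4]] : exists h0, [/\ 1 + M - b t < h0, -1 < h0, h0 < 1 + M - a t & -1 <= h0 <= 4].
  have M2 := gs_bound G (mid l r); rewrite -/M in M2; have at0 := gs_bound G t.
  clear -M2 at0 aM g; have [?|?] := leP (1 + M - b t) 0.
    by exists ((1 + M - a t) / 2); split; lra.
  by exists ((1 + M - b t + (1 + M - a t)) / 2); split; lra.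
pose J := [set h | [/\ 1 + M - b t < h, -1 < h & h < 1 + M - a t]].
have iI x y : is_interval [set z | x < z < y].
  by move=> u v /= /andP[xu _] /andP[_ vy] z /andP[uz zv]; rewrite (lt_le_trans xu uz) (le_lt_trans zv vy).
have iJ : is_interval J.
  move=> x y [x1 x2 _] [_ _ y3] z /andP[xz zy].
  by split; [exact: lt_le_trans xz|exact: lt_le_trans xz|exact: le_lt_trans zy y3].
have iH : is_interval [set h | -1 < h < 1 + M - a t] by exact: iI.
pose B := [set p : V | (a t < ax p < b (l + r - t)) /\ J (height s p)].
have BS : B `<=` [set p : V | tube a b l r t (ax p) (height s p)].
  by move=> p [/andP[? ?] [? ? ?]]; apply/tubeP; split=> //; constructor 3.
have cB : connected B by exact: (@strip_connected [set x | a t < x < b (l + r - t)]).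
apply: (@connected_star _ _ B) => // p /tubeP[p1 p2 p3 p4 [p5|p5|p5]].
- exists [set p : V | a t < ax p < b t /\ -1 < height s p < 1 + M - a t]; split.
  + by move=> q [q1 /andP[q2 q3]]; exact: (tube_left G).
  + exact: (@strip_connected [set x | a t < x < b t] [set h | -1 < h < 1 + M - a t]).
  + by rewrite /= p1 p5 p3 p4.
  + have [q [q1 q2]] := point_exists ((a t + b t) / 2) s k4.
    have [m1 m2] := midf_lt g.
    exists q; rewrite /= q1 q2 m1 m2 k2 k3; split=> //.
    by rewrite /B /= q1 q2 m1 (lt_le_trans m2 bb).
- exists [set p : V | a (l + r - t) < ax p < b (l + r - t) /\ -1 < height s p < 1 + M - a t].
  split.
  + by move=> q [q1 /andP[q2 q3]]; exact: (tube_right G).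
  + exact: (@strip_connected [set x | a (l + r - t) < x < b (l + r - t)]
      [set h | -1 < h < 1 + M - a t]).
  + by rewrite /= p2 p5 p3 p4.
  + have [q [q1 q2]] := point_exists ((a (l + r - t) + b (l + r - t)) / 2) s k4.
    have [m1 m2] := midf_lt g'.
    exists q; rewrite /= q1 q2 m1 m2 k2 k3; split=> //.
    by rewrite /B /= q1 q2 m2 (le_lt_trans aa m1).
- have Bp : B p by rewrite /B /= p1 p2.
  by exists B; split=> //; exists p.
Qed.

(** Height 4 is above both inner roofs H1 and H2. Every point can be raised to it inside a connected
    strip chosen by the position of its abscissa relative to the obstacles, and the part above both
    roofs is the hub [B]. *)
Lemma outside_connected s : connected [set p : V | outside a b (mu_of s) (ax p) (height s p)].
Proof.
have sm := side_mu s; set mu := mu_of s in sm *.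
have m0 := side_gt0 sm; have m1 := side_le1 sm.
pose H1 := 1 + a (mid 0 mu) - b 0; pose H2 := 1 + a (mid mu 1) - b mu.
have H13 : H1 < 4 by have := gs_bound G (mid 0 mu); have := gs_bound G 0; have := gs_le G 0; rewrite /H1; lra.
have H23 : H2 < 4 by have := gs_bound G (mid mu 1); have := gs_bound G mu; have := gs_le G mu; rewrite /H2; lra.
have outE p : outside a b mu (ax p) (height s p) <-> [/\ -1 < height s p,
    ~ [/\ b 0 <= ax p, ax p <= a mu & height s p <= H1] &
    ~ [/\ b mu <= ax p, ax p <= a 1 & height s p <= H2]].
  rewrite /outside /inner.
  have -> : 0 + mu - 0 = mu by lra.
  by have -> : mu + 1 - mu = 1 by lra.
have bm := b_mono G (ltW m0); have am := a_mono G m1; have ab := gs_le G mu.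
pose J h1 h2 := [set h | [/\ -1 < h, h1 < h & h2 < h]].
have iJ h1 h2 : is_interval (J h1 h2).
  by move=> x y [x1 x2 x3] _ z /andP[xz _]; split; exact: lt_le_trans xz.
have J4 h1 h2 : h1 < 4 -> h2 < 4 -> J h1 h2 4 by move=> ? ?; split=> //; lra.
have iL x : is_interval [set z | z < x].
  by move=> u v _ /= vx z /andP[_ zv]; exact: le_lt_trans zv vx.
have iR x : is_interval [set z | x < z].
  by move=> u v /= xu _ z /andP[uz _]; exact: lt_le_trans xu uz.
have iLR x y : is_interval [set z | x < z < y].
  by move=> u v /= /andP[xu _] /andP[_ vy] z /andP[uz zv]; rewrite (lt_le_trans xu uz) (le_lt_trans zv vy).
pose B := [set p : V | True /\ J H1 H2 (height s p)].
have hh : -1 <= (4 : R) <= 4 by lra.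
have Bx x : exists q, B q /\ ax q = x /\ height s q = 4.
  by have [q [q1 q2]] := point_exists x s hh; exists q; rewrite /B /= q2; do 2?split=> //; exact: J4.
have m14 : -1 < 4 :> R by lra.
clear sm m0 m1 hh.
apply: (@connected_star _ _ B).
- by move=> p [_ [h0 h1 h2]]; apply/outE; split=> // -[_ _]; rewrite leNgt ?h1 ?h2.
- exact: (@strip_connected setT _ s _ (iJ H1 H2)).
have key (I K : set R) p : is_interval I -> is_interval K ->
    (forall q, I (ax q) -> K (height s q) -> outside a b mu (ax q) (height s q)) -> K 4 ->
    I (ax p) -> K (height s p) ->
    exists A : set V, [/\ A `<=` [set p : V | outside a b mu (ax p) (height s p)],
      connected A, A p & A `&` B !=set0].
  move=> iI iK sub K4 Ip Kp; exists [set p : V | I (ax p) /\ K (height s p)]; split=> //.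
  - by move=> q [? ?]; exact: sub.
  - exact: strip_connected.
  - by have [q [Bq [q1 q2]]] := Bx (ax p); exists q; split=> //; rewrite /= q1 q2.
move=> p /outE[p0 p1 p2].
have [x1|x1] := ltP (ax p) (b 0).
  apply: (key [set x | x < b 0] [set h | -1 < h]) => // q /= qx qh; apply/outE.
  by split=> // -[+ _ _]; rewrite leNgt ?qx ?(lt_le_trans qx bm).
have [x2|x2] := ltP (a 1) (ax p).
  apply: (key [set x | a 1 < x] [set h | -1 < h]) => // q /= qx qh; apply/outE.
  by split=> // -[_ + _]; rewrite leNgt ?qx ?(le_lt_trans am qx).
have [x3|x3] := ltP (a mu) (ax p).
  have [x4|x4] := ltP (ax p) (b mu).
    apply: (key [set x | a mu < x < b mu] [set h | -1 < h]) => //=; last by rewrite x3 x4.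
    move=> q /= /andP[qx qx'] qh; apply/outE.
    by split=> // -[+ + _]; rewrite !leNgt ?qx ?qx' ?andbF.
  have h2 : H2 < height s p by rewrite ltNge; apply/negP => ?; exact: p2.
  apply: (key [set x | a mu < x] (J H2 H2)) => //=.
  move=> q /= qx [qh qh' _]; apply/outE.
  by split=> // -[_ + +]; rewrite !leNgt ?qx ?qh'.
have h1 : H1 < height s p by rewrite ltNge; apply/negP => ?; exact: p1.
have [x4|x4] := ltP (ax p) (b mu).
  apply: (key [set x | x < b mu] (J H1 H1)) => //=.
  move=> q /= qx [qh qh' _]; apply/outE.
  by split=> // -[+ _ +]; rewrite !leNgt ?qx ?qh'.
have h2 : H2 < height s p by rewrite ltNge; apply/negP => ?; exact: p2.
apply: (key setT (J H1 H2)) => //=.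
move=> q _ [qh qh1 qh2]; apply/outE.
by split=> // -[_ _]; rewrite leNgt ?qh1 ?qh2.
Qed.

Lemma arch_connected c s t : orbit c t -> connected (arch s t).
Proof.
move=> oc; rewrite /arch; case: (pieceP a b (side_mu s) oc) => [[_ _ ->]|[l [r [f lt ->]]]].
  exact: outside_connected.
have oc' := family_refl (side_mu s) f lt oc.
have g := gs_open G oc; have g' := gs_open G oc'.
have tt : l + r - (l + r - t) = t by lra.
by apply: tube_connected; rewrite /mid; case: (leP t (l + r - t)) => ?; rewrite ?tt //; lra.
Qed.

Definition lake c : set V := [set p | exists t s, orbit c t /\ arch s t p].

Lemma lake_open c : open (lake c).
Proof.
have -> : lake c = \bigcup_(ts in [set ts : R * bool | orbit c ts.1]) arch ts.2 ts.1.
  apply/seteqP; split=> [p [t [s [oc pt]]]|p [[t s] /= oc pt]]; first by exists (t, s).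
  by exists t, s.
by apply: bigcup_open => ts _; exact: open_arch.
Qed.

(** A point at height 0 over the gap lies in the arches of both sides: it is the joint between
    consecutive tubes of a chain. *)
Lemma foot_exists c t : orbit c t -> exists p : V, forall s, arch s t p.
Proof.
move=> oc; have hh : -1 <= (0 : R) <= 4 by lra.
have [p [p1 p2]] := point_exists ((a t + b t) / 2) true hh.
have g := gs_open G oc.
exists p => s; apply: (piece_foot G (side_mu s) oc); first by rewrite p1; lra.
by rewrite /height in p2 *; case: s; lra.
Qed.

Lemma arch_link c t s p q : orbit c t -> arch s t p -> arch s t q ->
  connected_component (lake c) p q.
Proof.
move=> oc pt qt; apply: (conn_sub _ (arch_connected (s := s) oc) pt qt).
by move=> p' ?; exists t, s.
Qed.

Lemma lake_connected c : connected (lake c).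
Proof.
have /choice[z hz] : forall i, exists p : V, forall s, arch s (orbit_pt R c i) p.
  by move=> i; exact: foot_exists (orbit_ptP R c i).
have step i : connected_component (lake c) (z i) (z (i + 1)).
  have [j [k1 [k2 [e1 e2]]]] := orbit_pt_step R c i.
  have oi := orbit_ptP R c i; have oj := orbit_ptP R c j; have ok := orbit_ptP R c (i + 1).
  have E1 := piece_refl a b (side_mu true) oi.1 oj.1 e1.
  have E2 := piece_refl a b (side_mu false) oj.1 ok.1 e2.
  have z1 : arch true (orbit_pt R c i) (z j) by rewrite /arch E1; exact: hz.
  have z2 : arch false (orbit_pt R c j) (z (i + 1)) by rewrite /arch E2; exact: hz.
  exact: connected_component_trans (arch_link oi (hz i true) z1) (arch_link oj (hz j false) z2).
have all_z i : connected_component (lake c) (z 0) (z i).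
  have rf : connected_component (lake c) (z 0) (z 0).
    apply: connected_component_refl; exists (orbit_pt R c 0), true.
    by split; [exact: orbit_ptP|exact: hz].
  elim/int_ind: i => [|k ih|k ih] //.
    by apply: connected_component_trans ih _; rewrite (_ : Posz k.+1 = Posz k + 1); [exact: step|lia].
  apply: connected_component_trans ih _; apply: connected_component_sym.
  have -> : - (Posz k) = - (Posz k.+1) + 1 by lia.
  exact: step.
apply: conn_all => p q [t [s [ot pt]]] [t' [s' [ot' qt']]].
have [i ti] := orbitE ot; have [i' ti'] := orbitE ot'; subst t t'.
apply: connected_component_trans (arch_link ot pt (hz i s)) _.
apply: connected_component_trans _ (arch_link ot' (hz i' s') qt').
apply: connected_component_trans _ (all_z i').
exact: connected_component_sym (all_z i).
Qed.

Lemma lake_nonempty c : lake c !=set0.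
Proof.
have [p hp] := foot_exists (orbit_ptP R c 0); exists p, (orbit_pt R c 0), true.
by split; [exact: orbit_ptP|exact: hp].
Qed.

Lemma lake_domain c : domain (lake c).
Proof. by split; [exact: lake_nonempty|exact: lake_connected|exact: lake_open]. Qed.

Lemma piece_gt mu t x h : piece a b mu t x h -> -1 < h.
Proof. by rewrite /piece; case: ifP => _; [case|case: ifP => _; case; case]. Qed.

(** On opposite sides the two heights are negatives of each other and both exceed -1, so both are
    below 1, where [band] determines the colour. *)
Lemma lake_disj c c' p : lake c p -> lake c' p -> c = c'.
Proof.
move=> [t [s [ot pt]]] [t' [s' [ot' pt']]].
have [ss|ss] := eqVneq s s'.
  subst s'; exact: (piece_disj G (side_mu s) ot ot' pt pt').
have h1 := piece_gt pt; have h2 := piece_gt pt'.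
have hs : height s p = - height s' p by move: ss; case: s s' {pt pt' h1 h2} => [] [] //= _; rewrite opprB.
have h3 : height s p < 1 by lra.
have h4 : height s' p < 1 by lra.
exact: band_disj (piece_band G (side_mu s) ot pt h3) (piece_band G (side_mu s') ot' pt' h4).
Qed.

Definition shore : set V := [set p | forall c, ~ lake c p].

Lemma shore_side p : shore p -> exists s, 0 <= height s p /\
  forall c t, orbit c t -> ~ piece a b (mu_of s) t (ax p) (height s p).
Proof.
move=> Wp; have [h|h] := leP 10 (rad p); [exists true|exists false]; split.
- by rewrite /height; lra.
- by move=> c t oc pt; apply: (Wp c); exists t, true.
- by rewrite /height; lra.
- by move=> c t oc pt; apply: (Wp c); exists t, false.
Qed.

Lemma shore_bounds p : shore p -> 0 <= ax p <= 2 /\ 7 <= rad p <= 13.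
Proof.
move=> /shore_side[s [h0 np]].
have [x2 h3 _] := piece_cover G (side_mu s) h0 np.
by split=> //; move: h0 h3; rewrite /height; case: s {np} => *; lra.
Qed.

(** The planar approximation lifts by translation along the axis and radial scaling. As no
    transverse coordinate exceeds rad p, scaling moves each by at most the change of radius; e < 1
    keeps the new radius positive. *)
Lemma shore_closure c : shore `<=` closure (lake c).
Proof.
move=> p Wp; have [s [h0 np]] := shore_side Wp; have [_ rp] := shore_bounds Wp.
move=> N /nbhs_ballP[d /= d0 hN].
have e0 : 0 < Num.min (d / 2) (1 / 2) by rewrite lt_min; apply/andP; split; lra.
have [t [x1 [h1 [ot pt dx dh]]]] := piece_near G c (side_mu s) h0 np e0.
set e := Num.min _ _ in e0 dx dh.
have ed : e < d by rewrite /e gt_min; apply/orP; left; lra.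
have e1 : e < 1 by rewrite /e gt_min; apply/orP; right; lra.
pose r1 : R := if s then 10 + h1 else 10 - h1.
have dr : `|r1 - rad p| <= e.
  move: dh; rewrite /r1 /height; case: (s) => /= dh.
    by have -> : 10 + h1 - rad p = h1 - (rad p - 10) by lra.
  by rewrite -normrN; have -> : - (10 - h1 - rad p) = h1 - (10 - rad p) by lra.
pose q : V := mk x1 (fun i => r1 / rad p * co p i).
have r0 : 0 <= r1 / rad p by apply: divr_ge0; move: dr; rewrite ler_norml; lra.
have rq : rad q = r1.
  rewrite (@rad_scale _ _ p q _ r0); first by rewrite divfK//; lra.
  by move=> i; rewrite co_mk.
exists q; split.
  exists t, s; split=> //; rewrite /arch /= ax_mk.
  by have -> : height s q = h1 by rewrite /height rq /r1; case: (s); lra.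
apply: hN; split=> // i k; rewrite ord1; apply: le_lt_trans ed.
case: (unliftP ord0 k) => [j ->|->]; rewrite -normrN opprB; last first.
  by have -> : q 0 ord0 = x1 by exact: ax_mk.
have -> : q 0 (lift ord0 j) = r1 / rad p * co p j by exact: co_mk.
have -> : p 0 (lift ord0 j) = co p j by [].
have rp0 : 0 < rad p by lra.
have -> : r1 / rad p * co p j - co p j = (r1 - rad p) * (co p j / rad p).
  by field; rewrite gt_eqF.
rewrite normrM; apply: le_trans dr; rewrite ler_piMr// normrM normfV (gtr0_norm rp0).
by rewrite ler_pdivrMr// mul1r co_le_rad.
Qed.

Lemma lake_boundary c : boundary (lake c) = shore.
Proof.
apply/seteqP; split=> p; rewrite /boundary.
- move=> [clp np] c' cp'.
  have [q [cq c'q]] := clp _ (open_nbhs_nbhs (conj (@lake_open c') cp')).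
  apply: np; have /interior_id -> := @lake_open c.
  by rewrite (lake_disj cq c'q).
- by move=> Wp; split; [exact: shore_closure|move=> /interior_subset; exact: Wp].
Qed.

Lemma shore_coords p k : shore p -> `|p 0 k| <= 13.
Proof.
move=> Wp; have [x2 rp] := shore_bounds Wp; rewrite ler_norml.
case: (unliftP ord0 k) => [j ->|->]; last by rewrite -/(ax p); lra.
have rp0 : 0 < rad p by lra.
by have := co_le_rad j rp0; rewrite ler_norml /co; lra.
Qed.

(** With [shift], the nine affine maps from a cut value to a coordinate: None for the axial one,
    Some (s, f, g) for a roof on side s, in the family of [0, mu] if f and of [mu, 1] otherwise,
    where g tells the sign of the extremal coordinate. *)
Definition slope (k : option (bool * bool * bool)) : R :=
  if k is Some (s, _, g) then (if g then 1 else -1) * (if s then -1 else 1) else 1.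

Definition shift (k : option (bool * bool * bool)) : R :=
  if k is Some (s, f, g) then
    let M := a (if f then mid 0 (mu_of s) else mid (mu_of s) 1) in
    (if g then 1 else -1) * (if s then 11 + M else 9 - M)
  else 0.

Lemma slopeP k : slope k = 1 \/ slope k = -1.
Proof.
by case: k => [[[[] ?] []]|]; rewrite /slope; [right|left|left|right|left]; lra.
Qed.

Lemma shore_cut p : shore p -> exists i k v, cutval a b v /\ p 0 i = slope k * v + shift k.
Proof.
move=> Wp; have [s [h0 np]] := shore_side Wp; have [x2 rp] := shore_bounds Wp.
have rp0 : 0 < rad p by lra.
have [_ _ cv] := piece_cover G (side_mu s) h0 np.
have [i ei] := rad_attained rp0.
have key f : let M := a (if f then mid 0 (mu_of s) else mid (mu_of s) 1) in
    cutval a b (1 + M - height s p) -> exists i k v, cutval a b v /\ p 0 i = slope k * v + shift k.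
  move=> M cM; exists (lift ord0 i), (Some (s, f, 0 <= co p i)), (1 + M - height s p).
  split=> //; rewrite -/(co p i) /slope /shift -/M /height.
  have := ei; have [c0|c0] := leP 0 (co p i).
    by rewrite ger0_norm// => ->; case: (s); lra.
  by rewrite ltr0_norm// => /eqP; rewrite eqr_oppLR => /eqP ->; case: (s); lra.
case: cv => [cx|c1|c2]; [|exact: (key true)|exact: (key false)].
by exists ord0, None, (ax p); split=> //; rewrite /slope /shift mul1r addr0.
Qed.

(** Near the axis of the picture, over a right end of a gap, the boundary contains a box of
    dimension m + 1. These boxes feed the lower count. *)
Lemma cut_in_shore c t p : orbit c t -> ax p = b t -> 10 <= co p ord0 <= 10 + 1 / 4 ->
  (forall i, i != ord0 -> 0 <= co p i <= 1 / 4) -> shore p.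
Proof.
move=> oc px p0 pi c' [u [s [ou pu]]].
have rp : rad p = co p ord0.
  apply: rad_eq => //; first lra.
  move=> j; have [->//|j0] := eqVneq j ord0.
  by have hj := pi _ j0; rewrite !ger0_norm; lra.
have hh : height s p < 1 by rewrite /height rp; case: (s); lra.
have := piece_band G (side_mu s) ou pu hh; rewrite px.
exact: (band_right_end G oc).
Qed.

End Domains.

(** * Box counting *)

Section BoxNumber.
Variables (R : realType) (n : nat).
Implicit Types (S : set 'rV[R]_n) (eps : R).

Lemma fin_cover S eps (X : finType) (c : X -> 'rV[R]_n) :
  (forall x, S x -> exists i, cube (c i) eps x) -> covered_by_cubes S eps #|X|.
Proof.
move=> h; exists (fun j => c (enum_val j)) => x /h[i xi].
by exists (enum_rank i) => //=; rewrite enum_rankK.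
Qed.

Lemma box_numberP S eps k : covered_by_cubes S eps k ->
  covered_by_cubes S eps (box_number S eps) /\ (box_number S eps <= k)%N.
Proof.
move=> ck; pose P k := `[< covered_by_cubes S eps k >].
have exP : exists k, P k by exists k; apply/asboolP.
have [j /asboolP cj minj] := ex_minnP exP.
have [c1 c2] : [set k | covered_by_cubes S eps k /\
    forall l, covered_by_cubes S eps l -> (k <= l)%N] (box_number S eps).
  by apply: xgetPex; exists j; split=> // l /asboolP; exact: minj.
by split=> //; exact: c2.
Qed.

Lemma separated_card S eps (X : finType) (pt : X -> 'rV[R]_n) k :
  (forall x, S (pt x)) ->
  (forall x y, x != y -> exists i, eps < `|pt x 0 i - pt y 0 i|) ->
  covered_by_cubes S eps k -> (#|X| <= k)%N.
Proof.
move=> ptS sep [c cov].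
have /choice[f hf] : forall x, exists j, cube (c j) eps (pt x).
  by move=> x; have [j _ ?] := cov _ (ptS x); exists j.
rewrite -(card_ord k); apply: (@leq_card _ _ f) => x y fxy; apply: contrapT => /eqP xy.
have [i] := sep _ _ xy; have := hf x i; have := hf y i; rewrite fxy.
by rewrite ltNge ler_norml => ? ? /negP; apply; lra.
Qed.

End BoxNumber.

Lemma limf_right_approx (R : realType) (g : R -> R) (l : R) :
  (forall e, 0 < e -> exists2 r, 0 < r & forall x, 0 < x < r -> `|g x - l| <= e) ->
  limf_esup (EFin \o g) 0^'+ = l%:E.
Proof.
move=> h; rewrite limf_esupE; apply/eqP; rewrite eq_le; apply/andP; split.
- apply/lee_addgt0Pr => e e0; have [r r0 hr] := h _ e0.
  apply: (@le_trans _ _ (ereal_sup ((EFin \o g) @` [set x | 0 < x < r]))).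
    apply: ereal_inf_lbound; exists [set x | 0 < x < r] => //.
    near=> x; apply/andP; split; near: x; [exact: nbhs_right_gt|exact: nbhs_right_lt].
  apply: ge_ereal_sup => _ [x /= /hr xr <-]; rewrite -EFinD lee_fin.
  by move: xr; rewrite ler_norml; lra.
- apply: le_ereal_inf_tmp => _ [V FV <-].
  apply/lee_addgt0Pr => e e0; have [r r0 hr] := h _ e0.
  have [x [Vx xr]] : exists x, V x /\ 0 < x < r.
    apply: (@filter_ex _ _ (at_right_proper_filter (0 : R))); near=> x; split.
      by near: x.
    apply/andP; split; near: x; [exact: nbhs_right_gt|exact: nbhs_right_lt].
  apply: (@le_trans _ _ ((g x)%:E + e%:E)%E).
    by have := hr _ xr; rewrite -EFinD lee_fin ler_norml; lra.
  by apply: leeD2r; apply: le_ereal_sup_tmp; exists (g x)%:E => //; exists x.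
Unshelve. all: by end_near. Qed.

Section GapSystem.
Variables (R : realType) (s : R) (p : nat -> R).
Hypothesis s01 : 0 <= s <= 1.
Hypothesis pE : forall t, (exists c, orbit c t) <-> (exists k, p k = t).

Lemma enum01 k : 0 <= p k < 1.
Proof. by have [c []] : exists c, orbit c (p k) by apply/pE; exists k. Qed.

Lemma gaps_system : gap_system (gapl s p) (gapr s p).
Proof.
have p01 := enum01; split.
- exact: gapl_le_gapr.
- exact: gapr_le_gapl.
- move=> c t oc; have [k <-] : exists k, p k = t by apply/pE; exists c.
  exact: gap_lt.
- move=> t no; apply: gap_eq => k; apply/eqP => pk; apply: no; apply/pE; by exists k.
- exact: gap_right_cont.
- exact: gap_left_cont.
- exact: gap_locate.
- by move=> t; rewrite mass_ge0// mass_le2.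
Qed.

Lemma cuts_cover_vals M e : 2 ^- (M ^ 2 + 3 * M) <= e ->
  exists c : 'I_(4 * 2 ^ cexp s M) -> R,
    forall v, cutval (gapl s p) (gapr s p) v -> exists j, c j <= v <= c j + e.
Proof.
move=> Me; have [c hc] := cuts_cover p s01 Me; exists c => v [t [->|->]]; apply: hc.
  by exists t; left.
by exists t; right.
Qed.

End GapSystem.

(** * Upper and lower bounds for the box number of the boundary *)

Section Counting.
Variables (R : realType) (m : nat) (s : R) (p : nat -> R).
Hypothesis s01 : 0 <= s <= 1.
Hypothesis p_inj : injective p.
Hypothesis pE : forall t, (exists c, orbit c t) <-> (exists k, p k = t).
Local Notation W := (@shore R m (gapl s p) (gapr s p)).
Let G := gaps_system s01 pE.

(** One coordinate is governed by one of the 9 affine maps and one of the 4 * 2 ^ cexp s M intervals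
    covering the cut values; the other m + 1 range over [-13, 13], cut into q cells. *)
Lemma shore_cover M (e : R) (q : nat) : 0 < e -> 2 ^- (M ^ 2 + 3 * M) <= e -> 26 < q%:R * e ->
  covered_by_cubes W e ((4 * 2 ^ cexp s M) * (m.+2 * 9) * q ^ m.+1)%N.
Proof.
move=> e0 Me qe; have [c hc] := cuts_cover_vals p s01 Me.
set N := (4 * 2 ^ cexp s M)%N in c hc *.
pose X := ('I_N * ('I_m.+2 * option (bool * bool * bool)) * {ffun 'I_m.+1 -> 'I_q})%type.
have -> : (N * (m.+2 * 9) * q ^ m.+1)%N = #|{: X}|.
  by rewrite !card_prod card_option !card_prod card_bool card_ffun !card_ord.
(* A map of slope -1 reverses the interval [c, c + e], so its lower end is shift - c - e. *)
pose ctr (x : X) : 'rV[R]_m.+2 := \row_l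
  if unlift x.1.2.1 l is Some l' then -13 + (x.2 l')%:R * e
  else let k := x.1.2.2 in
    if slope R k == 1 then c x.1.1 + shift (gapl s p) k else shift (gapl s p) k - c x.1.1 - e.
apply: (@fin_cover _ _ _ _ _ ctr) => z Wz.
have [i [k [v [cv zi]]]] := shore_cut G Wz.
have [j hj] := hc _ cv.
pose w (l : 'I_m.+2) := Num.truncn ((z 0 l + 13) / e).
have tr l : (w l < q)%N /\
    (w l)%:R * e <= z 0 l + 13 <= (w l)%:R * e + e.
  have := shore_coords G l Wz; rewrite ler_norml => zl.
  have pos : 0 <= (z 0 l + 13) / e by apply: divr_ge0; lra.
  have /andP[h1 h2] := truncn_itv pos; rewrite -/(w l) in h1 h2.
  rewrite ler_pdivlMr// in h1.
  rewrite -[(w l).+1%:R]natr1 ltr_pdivrMr// mulrDl mul1r in h2.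
  split; last by lra.
  rewrite -(ltr_nat R) -(ltr_pM2r e0); lra.
pose f := [ffun l' : 'I_m.+1 => Ordinal (tr (lift i l')).1].
exists ((j, (i, k)), f) => l; rewrite !mxE /=.
case: (unliftP i l) => [l' ->|->].
  by rewrite ffunE /=; have := (tr (lift i l')).2; lra.
rewrite zi; case: (slopeP R k) => ->; rewrite ?eqxx; first by lra.
by rewrite (_ : -1 == 1 = false); [lra|apply/negbTE; lra].
Qed.

(** The points are products of the first 2 ^ cexp s M right ends with a grid of step 2 e in the
    transverse coordinates; the bound on q keeps the grid within 1 / 4. *)
Lemma shore_separated M (e : R) (q k : nat) : 0 < e -> e < 2 ^- (M ^ 2 + 3 * M) ->
  q%:R * (16 * e) <= 2 -> covered_by_cubes W e k -> (2 ^ cexp s M * q ^ m.+1 <= k)%N.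
Proof.
move=> e0 eM qe cov.
pose X := ('I_(2 ^ cexp s M) * {ffun 'I_m.+1 -> 'I_q})%type.
have -> : (2 ^ cexp s M * q ^ m.+1)%N = #|{: X}|.
  by rewrite card_prod card_ffun !card_ord.
pose pt (x : X) : 'rV[R]_m.+2 := mk (gapr s p (p x.1))
  (fun l => (if l == ord0 then 10 else 0) + (x.2 l)%:R * (2 * e)).
have bd (x : X) l : 0 <= (x.2 l)%:R * (2 * e) <= 1 / 4.
  apply/andP; split; first by rewrite !mulr_ge0// ltW.
  have : (x.2 l)%:R * (16 * e) <= q%:R * (16 * e).
    by rewrite ler_pM2r ?mulr_gt0// ler_nat ltnW.
  lra.
apply: (@separated_card _ _ _ _ _ pt _ _ _ cov).
- move=> x; have [c oc] : exists c, orbit c (p x.1) by apply/pE; exists (val x.1).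
  apply: (cut_in_shore G oc); first by rewrite ax_mk.
    by rewrite co_mk eqxx; have := bd x ord0; lra.
  by move=> l l0; rewrite co_mk (negbTE l0) add0r; exact: bd.
- move=> [k1 f1] [k2 f2] xy.
  have [kk|kk] := eqVneq k1 k2; last first.
    exists ord0; have -> : forall x, pt x 0 ord0 = gapr s p (p x.1) by move=> x; exact: ax_mk.
    have -> : forall x, pt x 0 ord0 = gapr s p (p x.1) by move=> x; exact: ax_mk.
    apply: lt_le_trans eM _ => /=.
    have [pp|pp|pp] := ltgtP (p k1) (p k2).
    + rewrite distrC; apply: le_trans (gapr_sep s01 (ltn_ord k1) (ltn_ord k2) pp) (ler_norm _).
    + apply: le_trans (gapr_sep s01 (ltn_ord k2) (ltn_ord k1) pp) (ler_norm _).
    + by case/eqP: kk; apply/val_inj; exact: p_inj pp.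
  have [l fl] : exists l, f1 l != f2 l.
    apply/existsP; rewrite -negb_forall; apply: contra xy => /forallP h.
    by rewrite kk; apply/eqP; congr pair; apply/ffunP => l; apply/eqP.
  exists (lift ord0 l).
  have E x : pt x 0 (lift ord0 l) = (if l == ord0 then 10 else 0) + (x.2 l)%:R * (2 * e).
    exact: co_mk.
  rewrite !E /= opprD addrACA subrr add0r -mulrBl normrM (ger0_norm (mulr_ge0 _ (ltW e0)))//.
  have : 1 <= `|(f1 l)%:R - (f2 l)%:R| :> R.
    have [ff|ff] := leqP (f1 l) (f2 l).
      rewrite distrC -natrB// ger0_norm// ler1n subn_gt0 ltn_neqAle ff andbT.
      by apply: contra fl => /eqP h; apply/eqP/val_inj.
    by rewrite -natrB 1?ltnW// ger0_norm// ler1n subn_gt0.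
  by move=> h1; nra.
Qed.

End Counting.

(** To be read with x = M, t = ln 2, L = ln (1 / e), X = ln N and j = m + 1. Both X - j L and s L
    equal s x ^ 2 t up to an error linear in x. *)
Lemma log_count_arith (R : realType) (s x j t L X c c' k27 k16 k36 : R) :
  0 <= s <= 1 -> 1 <= x -> 0 < t -> 0 <= k36 -> 0 <= j * k27 -> 0 <= j * k16 ->
  (x ^+ 2 + 3 * x) * t <= L -> L <= ((x + 1) ^+ 2 + 3 * (x + 1)) * t ->
  s * x ^+ 2 + x - 1 <= c -> c' <= s * (x + 1) ^+ 2 + (x + 1) ->
  c * t + j * (L - k16) <= X -> X <= c' * t + k36 + j * (k27 + L) ->
  `|X - (s + j) * L| <= (5 * t + k36 + j * (k27 + k16)) * (x + 1).
Proof.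
move=> /andP[s0 s1] x1 t0 k36p k27p k16p L1 L2 hc hc' X1 X2.
have xt0 : 0 <= x * t by rewrite mulr_ge0 ?(le_trans ler01 x1)// ltW.
have sL1 := ler_wpM2l s0 L1; have sL2 := ler_wpM2l s0 L2.
have C1 : (s * x ^+ 2 + x - 1) * t <= c * t by rewrite ler_pM2r.
have C2 : c' * t <= (s * (x + 1) ^+ 2 + (x + 1)) * t by rewrite ler_pM2r.
have st : s * t <= t by rewrite ler_piMl// ltW.
have st0 : 0 <= s * t by rewrite mulr_ge0// ltW.
have sxt : s * (x * t) <= x * t by rewrite ler_piMl.
have sxt0 : 0 <= s * (x * t) by rewrite mulr_ge0.
have Kx : k36 + j * k27 + j * k16 <= (k36 + j * k27 + j * k16) * (x + 1).
  by rewrite ler_peMr ?addr_ge0//; lra.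
have p1 : s * ((x ^+ 2 + 3 * x) * t) = s * x ^+ 2 * t + 3 * (s * (x * t)) by ring.
have p2 : s * (((x + 1) ^+ 2 + 3 * (x + 1)) * t) =
  s * x ^+ 2 * t + 5 * (s * (x * t)) + 4 * (s * t) by ring.
have p3 : (s * x ^+ 2 + x - 1) * t = s * x ^+ 2 * t + x * t - t by ring.
have p4 : (s * (x + 1) ^+ 2 + (x + 1)) * t =
  s * x ^+ 2 * t + 2 * (s * (x * t)) + s * t + x * t + t by ring.
have p5 : (5 * t + k36 + j * (k27 + k16)) * (x + 1) =
  5 * (x * t) + 5 * t + (k36 + j * k27 + j * k16) * (x + 1) by ring.
have p6 : (s + j) * L = s * L + j * L by ring.
rewrite mulrBr in X1; rewrite mulrDr in X2.
rewrite p5 p6 ler_norml; rewrite p1 in sL1; rewrite p2 in sL2; rewrite p3 in C1; rewrite p4 in C2.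
clear p1 p2 p3 p4 p5 p6 L1 L2 hc hc' x1.
(* Naming the products as variables leaves a linear problem. *)
move: (s * x ^+ 2 * t) (s * (x * t)) (x * t) (s * t) (s * L) (j * L) (j * k27) (j * k16)
  (c * t) (c' * t) ((_ + _) * (x + 1)) sL1 sL2 C1 C2 st st0 sxt sxt0 Kx X1 X2 k36p k27p k16p xt0 t0.
by move=> {x c c' L s0 s1 j k27 k16} y1 y2 y3 y4 y5 y6 y7 y8 y9 y10 y11 *; apply/andP; split; lra.
Qed.

Section Dimension.
Variables (R : realType) (m : nat) (s : R) (p : nat -> R).
Hypothesis s01 : 0 <= s <= 1.
Hypothesis p_inj : injective p.
Hypothesis pE : forall t, (exists c, orbit c t) <-> (exists k, p k = t).
Local Notation W := (@shore R m (gapl s p) (gapr s p)).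

Lemma scale_exists (e : R) (M0 : nat) : 0 < e -> e < 2 ^- (M0 ^ 2 + 3 * M0) ->
  exists2 M, (M0 <= M)%N & 2 ^- (M.+1 ^ 2 + 3 * M.+1) <= e < 2 ^- (M ^ 2 + 3 * M).
Proof.
move=> e0 eM0; pose P k := 2 ^- (k ^ 2 + 3 * k) <= e.
have exP : exists k, P k.
  have [k ke] := wexp_small s01 e0; exists k; apply: le_trans (ltW ke).
  have le1 : 2 ^- (k ^ 2 + 3 * k) <= 2 ^- wexp s k :> R.
    rewrite lef_pV2 ?posrE ?exprn_gt0// ler_eXn2l ?ltr1n// -(cwexp s01 k).
    exact: leq_addl.
  apply: le_trans le1 _; rewrite ler_peMl ?ler1n// invr_ge0 exprn_ge0//.
have [j Pj minj] := ex_minnP exP.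
have jM : (M0 < j)%N.
  rewrite ltnNge; apply/negP => jM.
  have : 2 ^- (M0 ^ 2 + 3 * M0) <= 2 ^- (j ^ 2 + 3 * j) :> R.
    rewrite lef_pV2 ?posrE ?exprn_gt0// ler_eXn2l ?ltr1n//.
    by rewrite leq_add// ?leq_mul// leq_exp2r.
  by move: Pj; rewrite /P => h1 h2; have := lt_le_trans eM0 (le_trans h2 h1); rewrite ltxx.
case: j => // M in Pj minj jM *; exists M => //; apply/andP; split=> //.
by rewrite ltNge; apply/negP => /minj; rewrite ltnn.
Qed.

Lemma cexp_bounds M :
  s * M%:R ^+ 2 + M%:R - 1 <= (cexp s M)%:R <= s * M%:R ^+ 2 + M%:R.
Proof.
have := sq_floor_itv s01 M; rewrite /cexp natrD natrX -natr1; lra.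
Qed.

Lemma shore_log_count (e : R) (M : nat) (N := box_number W e) (L := ln (1 / e)) :
  (0 < M)%N -> 0 < e -> 2 ^- (M.+1 ^ 2 + 3 * M.+1) <= e < 2 ^- (M ^ 2 + 3 * M) ->
  (cexp s M)%:R * ln 2 + m.+1%:R * (L - ln 16) <= ln N%:R <=
  (cexp s M.+1)%:R * ln 2 + ln (36 * m.+2%:R) + m.+1%:R * (ln 27 + L).
Proof.
move=> M0 e0 /andP[Me eM].
(* M >= 1 gives 2 ^- (1 + 3). With 1 / e >= 16 the roundings are absorbed: q <= 27 / e and q' >= 1 /
   (16 e). The constant 36 is 4 * 9. *)
have e16 : e <= 1 / 16.
  apply: le_trans (ltW eM) _; rewrite div1r.
  have -> : 16 = 2 ^+ 4 :> R by ring.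
  rewrite lef_pV2 ?posrE ?exprn_gt0// ler_eXn2l ?ltr1n//.
  by case: (M) M0 => // k _; lia.
have ie0 : 0 < 1 / e by rewrite divr_gt0.
have ie16 : 16 <= 1 / e by rewrite ler_pdivlMr//; lra.
have e1 : 1 / e * e = 1 by rewrite divfK// gt_eqF.
pose q := (Num.truncn (26 / e)).+1; pose q' := Num.truncn (1 / (8 * e)).
have pos1 : 0 <= 26 / e by rewrite divr_ge0// ltW.
have pos2 : 0 <= 1 / (8 * e) by rewrite divr_ge0// mulr_ge0// ltW.
have /andP[q1 q2] := truncn_itv pos1; rewrite -/q in q2.
have /andP[q3 q4] := truncn_itv pos2; rewrite -/q' in q3 q4.
have e26 : 26 / e = 26 * (1 / e) by rewrite mulrA mulr1.
have e8 : 1 / (8 * e) = 1 / e / 8 by rewrite !div1r invfM mulrC.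
have qle : q%:R <= 27 * (1 / e) by rewrite /q -natr1; lra.
have q'ge : 1 / e / 16 <= q'%:R.
  by rewrite -[q'.+1%:R]natr1 in q4; lra.
have qe : 26 < q%:R * e by rewrite -ltr_pdivrMr.
have q'e : q'%:R * (16 * e) <= 2.
  have -> : 2 = (1 / e / 8) * (16 * e) by field; rewrite gt_eqF.
  by rewrite ler_pM2r ?mulr_gt0//; lra.
have cov := shore_cover m s01 pE e0 Me qe.
have [covN Nle] := box_numberP cov.
have Nge := shore_separated s01 p_inj pE e0 eM q'e covN.
rewrite -/N in Nle Nge.
have l2 : 0 < ln (2 : R) by rewrite ln_gt0// ltr1n.
apply/andP; split.
- have -> : (cexp s M)%:R * ln 2 + m.+1%:R * (L - ln 16) =
      ln (2 ^+ cexp s M * (1 / e / 16) ^+ m.+1).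
    rewrite lnM ?posrE ?exprn_gt0 ?divr_gt0// !lnXn ?divr_gt0//.
    by rewrite ln_div ?posrE// -/L !mulr_natl.
  have x0 : 0 < 2 ^+ cexp s M * (1 / e / 16) ^+ m.+1.
    by rewrite mulr_gt0 ?exprn_gt0 ?divr_gt0.
  have le1 : 2 ^+ cexp s M * (1 / e / 16) ^+ m.+1 <= N%:R.
    apply: (@le_trans _ _ (2 ^ cexp s M * q' ^ m.+1)%N%:R); last by rewrite ler_nat.
    rewrite natrM !natrX ler_pM2l ?exprn_gt0// lerXn2r ?nnegrE//.
    by rewrite !divr_ge0// ltW.
  by rewrite ler_ln ?posrE//; exact: lt_le_trans le1.
- have N0 : 0 < N%:R :> R.
    apply: (@lt_le_trans _ _ (2 ^ cexp s M * q' ^ m.+1)%N%:R); last by rewrite ler_nat.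
    rewrite ltr0n muln_gt0 !expn_gt0 /=; apply/orP; left.
    by rewrite -(ltr_nat R); apply: lt_le_trans q'ge; rewrite divr_gt0.
  have pA : 0 < 2 ^+ cexp s M.+1 :> R by rewrite exprn_gt0.
  have pB : 0 < 36 * m.+2%:R :> R by rewrite mulr_gt0.
  have pC : 0 < 27 * (1 / e) by rewrite mulr_gt0.
  have -> : (cexp s M.+1)%:R * ln 2 + ln (36 * m.+2%:R) + m.+1%:R * (ln 27 + L) =
      ln (2 ^+ cexp s M.+1 * (36 * m.+2%:R) * (27 * (1 / e)) ^+ m.+1).
    rewrite [RHS]lnM ?posrE ?(mulr_gt0 pA pB) ?(exprn_gt0 _ pC)//.
    rewrite [ln (_ * (36 * _))]lnM ?posrE//.
    rewrite (lnXn _ pC) [ln (27 * _)]lnM ?posrE// -/L.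
    by rewrite lnXn// !mulr_natl.
  rewrite ler_ln ?posrE ?(mulr_gt0 (mulr_gt0 pA pB) (exprn_gt0 _ pC))//.
  apply: (@le_trans _ _ (4 * 2 ^ cexp s M.+1 * (m.+2 * 9) * q ^ m.+1)%N%:R).
    by rewrite ler_nat.
  rewrite !natrM !natrX.
  have -> : 2 ^+ cexp s M.+1 * (36 * m.+2%:R) * (27 * (1 / e)) ^+ m.+1 =
    4 * 2 ^+ cexp s M.+1 * (m.+2%:R * 9) * (27 * (1 / e)) ^+ m.+1 :> R by ring.
  by rewrite ler_wpM2l ?mulr_ge0 ?exprn_ge0// lerXn2r ?nnegrE// mulr_ge0// ltW.
Qed.

(** The error K (M + 1) is at most 2 K M, while ln (1 / e) is at least M ^ 2 ln 2. *)
Lemma shore_ratio (e : R) (M : nat) (K := 5 * ln 2 + ln (36 * m.+2%:R) + m.+1%:R * (ln 27 + ln 16)) :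
  (0 < M)%N -> 0 < e -> 2 ^- (M.+1 ^ 2 + 3 * M.+1) <= e < 2 ^- (M ^ 2 + 3 * M) ->
  `|ln (box_number W e)%:R / ln (1 / e) - (s + m.+1%:R)| <= 2 * K / (M%:R * ln 2).
Proof.
move=> M0 e0 he; have /andP[X1 X2] := shore_log_count M0 e0 he.
have /andP[Me eM] := he.
have l2 : 0 < ln (2 : R) by rewrite ln_gt0// ltr1n.
have lE k : ln (2 ^+ k) = k%:R * ln 2 :> R by rewrite lnXn// mulr_natl.
have ie0 : 0 < 1 / e by rewrite divr_gt0.
have L1 : (M ^ 2 + 3 * M)%:R * ln 2 <= ln (1 / e).
  rewrite -lE ler_ln ?posrE ?exprn_gt0// div1r -[leLHS]invrK lef_pV2 ?posrE ?invr_gt0 ?exprn_gt0//.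
  exact: ltW.
have L2 : ln (1 / e) <= (M.+1 ^ 2 + 3 * M.+1)%:R * ln 2.
  by rewrite -lE ler_ln ?posrE ?exprn_gt0// div1r -[leRHS]invrK lef_pV2 ?posrE ?invr_gt0 ?exprn_gt0.
have M1 : 1 <= M%:R :> R by rewrite ler1n.
have [c1 _] := andP (cexp_bounds M); have [_ c2] := andP (cexp_bounds M.+1).
rewrite natrD natrX natrM in L1; rewrite natrD natrX natrM in L2.
rewrite -[M.+1%:R]natr1 in L2 c2.
have ln_nat k : 0 <= ln k.+1%:R :> R by rewrite ln_ge0// ler1n.
have pos36 : 0 <= ln (36 * m.+2%:R) :> R by rewrite -natrM; exact: ln_nat.
have main := log_count_arith s01 M1 l2 pos36 (mulr_ge0 (ler0n _ m.+1) (ln_nat 26))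
  (mulr_ge0 (ler0n _ m.+1) (ln_nat 15)) L1 L2 c1 c2 X1 X2.
have K0 : 0 <= K.
  apply: addr_ge0; first by rewrite addr_ge0// mulr_ge0// ltW.
  by rewrite mulr_ge0// addr_ge0.
rewrite -/K in main.
move: (ln (box_number W e)%:R) (ln (1 / e)) M%:R (ln 2) K m.+1%:R M1 l2 L1 K0 main.
move=> {e e0 he Me eM lE ie0 L2 c1 c2 ln_nat pos36 X1 X2 M M0} X L x t K j x1 t0 L1 K0 main.
have x0 : 0 < x := lt_le_trans ltr01 x1.
have L0 : x ^+ 2 * t <= L.
  by apply: le_trans L1; rewrite ler_pM2r// lerDl mulr_ge0// ltW.
have Lp : 0 < L by apply: lt_le_trans L0; rewrite mulr_gt0// exprn_gt0.
have -> : X / L - (s + j) = (X - (s + j) * L) / L by field; rewrite gt_eqF.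
rewrite normrM normfV (gtr0_norm Lp) ler_pdivrMr//.
apply: le_trans main _; apply: (@le_trans _ _ (2 * K / (x * t) * (x ^+ 2 * t))).
  have -> : 2 * K / (x * t) * (x ^+ 2 * t) = K * (x + x) by field; rewrite !gt_eqF.
  by rewrite ler_wpM2l// lerD2l.
by rewrite ler_wpM2l// divr_ge0// mulr_ge0// ltW.
Qed.

Lemma shore_dim : has_minkowski_dim W (s + m.+1%:R).
Proof.
have G := gaps_system s01 pE.
have approx (e : R) : 0 < e -> exists2 r, 0 < r &
    forall x, 0 < x < r -> `|ln (box_number W x)%:R / ln (1 / x) - (s + m.+1%:R)| <= e.
  move=> e0.
  set K := 5 * ln 2 + ln (36 * m.+2%:R) + m.+1%:R * (ln 27 + ln 16) : R.
  have l2 : 0 < ln (2 : R) by rewrite ln_gt0// ltr1n.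
  pose M0 := (Num.truncn (2 * K / (e * ln 2))).+1.
  exists (2 ^- (M0 ^ 2 + 3 * M0)); first by rewrite invr_gt0 exprn_gt0.
  move=> x /andP[x0 xM].
  have [M MM hM] := scale_exists x0 xM.
  have Mp : (0 < M)%N by apply: leq_trans MM.
  apply: le_trans (shore_ratio Mp x0 hM) _; rewrite -/K.
  have Mr : 0 < M%:R :> R by rewrite ltr0n.
  rewrite ler_pdivrMr ?mulr_gt0// mulrCA -ler_pdivrMr ?mulr_gt0//.
  have : 2 * K / (e * ln 2) < M0%:R by exact: truncnS_gt.
  by move=> /ltW /le_trans; apply; rewrite ler_nat.
split.
- exists 13; split=> // r r13 z Wz /=; apply: le_trans (ltW r13).
  rewrite [leLHS]/Num.Def.normr /= mx_normrE; apply/bigmax_leP; split=> // -[i j] _ /=.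
  by rewrite ord1; have := shore_coords G j Wz.
- exact: limf_right_approx approx.
- rewrite /lower_minkowski_dim /limf_einf.
  have -> : (\- box_ratio W)%E = EFin \o (fun x => - (ln (box_number W x)%:R / ln (1 / x))).
    by apply/funext.
  rewrite (@limf_right_approx _ _ (- (s + m.+1%:R))) ?EFinN ?oppeK// => e /approx[r r0 hr].
  by exists r => // x /hr; rewrite -opprD normrN.
Qed.

End Dimension.

Theorem corollary1p6 (R : realType) (n : nat) (hn : (2 <= n)%N) (d : R)
    (hd : n%:R - 1 <= d <= n%:R) :
  exists U1 U2 U3 W : set 'rV[R]_n,
    [/\ domain U1, domain U2 & domain U3] /\
    [/\ U1 `&` U2 = set0, U1 `&` U3 = set0 & U2 `&` U3 = set0] /\
    [/\ W = boundary U1, W = boundary U2 & W = boundary U3] /\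
    has_minkowski_dim W d.
Proof.
case: n hn hd => [//|[//|m]] _ hd.
have s01 : 0 <= d - m.+1%:R <= 1 by move: hd; rewrite -[m.+2%:R]natr1; lra.
have [p [p_inj pE]] := orbit_enum R.
have G := gaps_system s01 pE.
pose U := @lake R m (gapl (d - m.+1%:R) p) (gapr (d - m.+1%:R) p).
have disj c c' : c != c' -> U c `&` U c' = set0.
  move=> cc; apply/seteqP; split=> // x [xc xc'].
  by move: cc; rewrite (lake_disj G xc xc') eqxx.
(* Three of the four lakes are taken; W is the complement of all four, which is the boundary of
   each. *)
exists (U (false, false)), (U (false, true)), (U (true, false)).
exists (@shore R m (gapl (d - m.+1%:R) p) (gapr (d - m.+1%:R) p)).
split; first by split; exact: lake_domain.
split; first by split; exact: disj.
split; first by split; rewrite lake_boundary.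
by have := shore_dim m s01 p_inj pE; rewrite subrK.
Qed.
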